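(* Let $G$ be a countable discrete infinite amenable group acting continuously on a compact metric space $(X,d)$, let $\{F_n\}$ be a strictly increasing Følner sequence in $G$ and $\mathbf{b}=\{b(n)\}$ a scaled sequence such that $b(|F_n|)\ge |F_n|$ for all $n\in\mathbb{N}$. Let $f\in C(X,\mathbb{R})$ and let $Z\subset X$ be a nonempty compact set. If $P^{P}(Z,\{F_n\},f,\mathbf{b})>\|f\|$, where $\|f\|:=\sup_{x\in X}|f(x)|$, then $$\begin{aligned}P^{P}(Z,\{F_n\},f,\mathbf{b})&=\sup\{\overline{P}_\mu(\{F_n\},f,\mathbf{b}):\mu\in M(X),\ \mu(Z)=1\}\\&=\sup\{P^{P}_\mu(\{F_n\},f,\mathbf{b}):\mu\in M(X),\ \mu(Z)=1\}\\&=\sup\{P^{KP}_\mu(\{F_n\},f,\mathbf{b}):\mu\in M(X),\ \mu(Z)=1\}.\end{aligned}$$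
   Context: $M(X)$ is the set of Borel probability measures on $X$. $F(G)$ is the collection of nonempty finite subsets of $G$. A Følner sequence is a sequence $\{F_n\}_{n\in\mathbb{N}}\subseteq F(G)$ with $\lim_{n\to\infty}|F_n\triangle gF_n|/|F_n|=0$ for all $g\in G$; it is strictly increasing if $F_n\subsetneq F_{n+1}$ for all $n$. A scaled sequence is a sequence $\mathbf{b}=\{b(n)\}_{n\in\mathbb{N}}$ of positive numbers monotonically increasing to infinity. $C(X,\mathbb{R})$ is the set of continuous functions $X\to\mathbb{R}$. For $F\in F(G)$, $d_F(x,y)=\max_{g\in F}d(gx,gy)$, $B_F(x,\varepsilon)=\{y\in X:d_F(x,y)<\varepsilon\}$, $\overline{B}_F(x,\varepsilon)=\{y\in X:d_F(x,y)\le\varepsilon\}$, and $f_F(x)=\sum_{g\in F}f(gx)$. For $\mu\in M(X)$ and $x\in X$, $$\overline{P}_\mu(x,\{F_n\},f,\mathbf{b})=\lim_{\varepsilon\to0}\limsup_{n\to+\infty}\frac{-\log\mu(B_{F_n}(x,\varepsilon))+f_{F_n}(x)}{b(|F_n|)},\qquad \overline{P}_\mu(\{F_n\},f,\mathbf{b})=\int_X\overline{P}_\mu(x,\{F_n\},f,\mathbf{b})\,\mathrm{d}\mu(x).$$ For $Z\subseteq X$, $N\in\mathbb{N}$, $\alpha\in\mathbb{R}$, $\varepsilon>0$ (dependence on $\{F_n\},f,\mathbf{b}$ suppressed), $M^{P}(N,\alpha,\varepsilon,Z)=\sup\sum_i e^{-\alpha b(|F_{n_i}|)+f_{F_{n_i}}(x_i)}$,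 the supremum over all finite or countable pairwise disjoint collections $\{\overline{B}_{F_{n_i}}(x_i,\varepsilon)\}_i$ with $x_i\in Z$, $n_i\ge N$; $M^{P}(\alpha,\varepsilon,Z)=\lim_{N\to\infty}M^{P}(N,\alpha,\varepsilon,Z)$; $M^{\mathcal{P}}(\alpha,\varepsilon,Z)=\inf\{\sum_{i=1}^\infty M^{P}(\alpha,\varepsilon,Z_i):Z\subseteq\bigcup_{i=1}^\infty Z_i\}$. As a function of $\alpha$, $M^{\mathcal{P}}(\alpha,\varepsilon,Z)$ jumps from $+\infty$ to $0$ at a critical value $P^{P}(\varepsilon,Z)=\inf\{\alpha:M^{\mathcal{P}}(\alpha,\varepsilon,Z)=0\}=\sup\{\alpha:M^{\mathcal{P}}(\alpha,\varepsilon,Z)=+\infty\}$ (with $\inf\emptyset=+\infty$, $\sup\emptyset=-\infty$), and $P^{P}(Z,\{F_n\},f,\mathbf{b})=\lim_{\varepsilon\to0}P^{P}(\varepsilon,Z)$. For $\mu\in M(X)$, $P^{P}_\mu(\{F_n\},f,\mathbf{b})=\lim_{\varepsilon\to0}\lim_{\delta\to0}\inf\{P^{P}(\varepsilon,Y):Y\subseteq X\text{ measurable},\ \mu(Y)\ge1-\delta\}$. For $\mu\in M(X)$ and $0<\delta<1$, $M^{\mathcal{P}}_\mu(\alpha,\varepsilon,\delta)=\inf\{\sum_{i=1}^\infty M^{P}(\alpha,\varepsilon,Z_i):\mu(\bigcup_{i=1}^\infty Z_i)\ge1-\delta\}$ (the union being measurable); $P^{KP}_\mu(\varepsilon,\delta)=\inf\{\alpha:M^{\mathcal{P}}_\mu(\alpha,\varepsilon,\delta)=0\}=\sup\{\alpha:M^{\mathcal{P}}_\mu(\alpha,\varepsilon,\delta)=+\infty\}$;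 and $P^{KP}_\mu(\{F_n\},f,\mathbf{b})=\lim_{\varepsilon\to0}\lim_{\delta\to0}P^{KP}_\mu(\varepsilon,\delta)$. *)

(* Defs.v *)
From HB Require Import structures.
From mathcomp Require Import all_boot all_order all_algebra finmap.
From mathcomp Require Import all_classical all_reals all_analysis.

Set Implicit Arguments.
Unset Strict Implicit.
Unset Printing Implicit Defensive.

Import Order.TTheory GRing.Theory Num.Theory.
Import numFieldNormedType.Exports.

Local Open Scope classical_set_scope.
Local Open Scope ring_scope.

Section groups.
Context (R : realType) (G : groupType).
Local Open Scope fset_scope.

Definition left_translate (g : G) (A : {fset G}) : {fset G} :=
  [fset (g * h)%g | h in A].

Definition fsymdiff (A B : {fset G}) : {fset G} := (A `\` B) `|` (B `\` A).

Definition Folner (F : nat -> {fset G}) : Prop :=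
  (forall n, F n != fset0) /\
  forall g : G,
    (#|` fsymdiff (F n) (left_translate g (F n)) |%:R / #|` F n |%:R : R)
      @[n --> \oo] --> (0 : R).

Definition strictly_increasing (F : nat -> {fset G}) : Prop :=
  forall n, F n `<` F n.+1.

(* For countable groups, amenability is the existence of a Folner sequence. *)
Definition amenable : Prop := exists F : nat -> {fset G}, Folner F.

(* G carries the discrete topology, so joint continuity of G x X -> X is
   continuity of every map x |-> g x. *)
Definition continuous_action (X : topologicalType) (act : G -> X -> X) : Prop :=
  [/\ forall x, act 1%g x = x,
      forall g h x, act (g * h)%g x = act g (act h x) &
      forall g, continuous (act g)].

End groups.

Definition scaled_sequence (R : realType) (b : nat -> R) : Prop :=
  [/\ forall n, 0 < b n,
      {homo b : m n / (m <= n)%N >-> m <= n} &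
      b n @[n --> \oo] --> +oo].

(* The library's measurable spaces are pointed types, so the Borel sigma-algebra
   is built on a pointed metric space; the distinguished point plays no role
   elsewhere, and a nonempty metric space always has one. *)
#[short(type="pMetricType")]
HB.structure Definition PointedMetric (R : numDomainType) :=
  {M of Metric R M & isPointed M}.

Notation borel X := (g_sigma_algebraType (@open X)).

Definition unif_norm (R : realType) (X : pMetricType R) (f : X -> R) : R :=
  sup [set `|f x| | x in [set: X]].

Section pressures.
Context (R : realType) (G : groupType) (X : pMetricType R).
Variables (act : G -> X -> X) (F : nat -> {fset G}) (f : X -> R) (b : nat -> R).
Implicit Types (A : {fset G}) (x y : X) (Z : set X) (a e d : R).
Implicit Types mu : probability (borel X) R.

(* Distances are nonnegative, so for nonempty A the default 0 is harmless. *)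
Definition bowen_dist A x y : R :=
  \big[Num.max/0]_(g <- A) mdist (act g x) (act g y).

Definition bowen_ball A x e : set X := [set y | bowen_dist A x y < e].

Definition bowen_cball A x e : set X := [set y | bowen_dist A x y <= e].

Definition birkhoff_sum A x : R := \sum_(g <- A) f (act g x).

Local Open Scope ereal_scope.

Definition upper_local_pressure mu x : \bar R :=
  lim (limn_esup (fun n =>
         (- lne (mu (bowen_ball (F n) x e)) + (birkhoff_sum (F n) x)%:E)
           / (b #|` F n|)%:E)
       @[e --> 0^'+]).

Definition upper_pressure mu : \bar R :=
  \int[mu]_x upper_local_pressure mu x.

(* The countable collection of balls is indexed by D : set nat, which may be
   finite, or empty with sum 0; so packing_N of the empty set is 0. *)
Definition packing N e Z (D : set nat) (x : nat -> X) (n : nat -> nat) : Prop :=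
  (forall i, D i -> Z (x i) /\ (N <= n i)%N) /\
  trivIset D (fun i => bowen_cball (F (n i)) (x i) e).

Definition packing_sum a (D : set nat) (x : nat -> X) (n : nat -> nat) : \bar R :=
  \esum_(i in D)
    (expR (- a * b #|` F (n i)| + birkhoff_sum (F (n i)) (x i)))%:E.

Definition packing_N N a e Z : \bar R :=
  ereal_sup [set s | exists (D : set nat) (x : nat -> X) (n : nat -> nat),
    packing N e Z D x n /\ s = packing_sum a D x n].

Definition packing_limit a e Z : \bar R :=
  lim (packing_N N a e Z @[N --> \oo]).

Definition packing_outer a e Z : \bar R :=
  ereal_inf [set \sum_(0 <= i <oo) packing_limit a e (Zs i)
            | Zs in [set Zs : nat -> set X | Z `<=` \bigcup_i Zs i]].

Definition packing_pressure_at e Z : \bar R :=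
  ereal_inf [set a%:E | a in [set a | packing_outer a e Z = 0]].

Definition packing_pressure Z : \bar R :=
  lim (packing_pressure_at e Z @[e --> 0^'+]).

Definition measure_packing_pressure mu : \bar R :=
  lim (lim (ereal_inf [set packing_pressure_at e Y
                      | Y in [set Y : set (borel X) | measurable Y /\
                                (1 - d)%:E <= mu Y]]
            @[d --> 0^'+])
       @[e --> 0^'+]).

Definition katok_packing_outer mu a e d : \bar R :=
  ereal_inf [set \sum_(0 <= i <oo) packing_limit a e (Zs i)
            | Zs in [set Zs : nat -> set (borel X) |
                measurable (\bigcup_i Zs i) /\
                (1 - d)%:E <= mu (\bigcup_i Zs i)]].

Definition katok_packing_pressure_at mu e d : \bar R :=
  ereal_inf [set a%:E | a in [set a | katok_packing_outer mu a e d = 0]].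

Definition katok_packing_pressure mu : \bar R :=
  lim (lim (katok_packing_pressure_at mu e d @[d --> 0^'+]) @[e --> 0^'+]).

End pressures.

(* Main.v *)
Require Import Defs.
From HB Require Import structures.
From mathcomp Require Import all_boot all_order all_algebra finmap.
From mathcomp Require Import all_classical all_reals all_analysis.
From mathcomp Require Import measurable_realfun ring lra.
Import Order.TTheory GRing.Theory Num.Theory.
Import numFieldNormedType.Exports.

Set Implicit Arguments.
Unset Strict Implicit.
Unset Printing Implicit Defensive.

Local Open Scope classical_set_scope.
Local Open Scope ring_scope.

(** Why the theorem is true. Write m = F n, B = b(|F n|), and let the weight of
    the Bowen ball of center x and index n at exponent s be exp(-s B + f_m(x)).
    The local rate of mu at x is (- log mu(ball) + f_m(x)) / B, so a rate at
    least s says exactly that the ball has measure at most its weight.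

    Upper bounds. Suppose that the upper limit of the rates at scale e exceeds s
    on a nonnegligible set E, and let a < s. The points of E at which the rate
    exceeds s at time n are covered by finitely many balls of radius e, such that
    the closed balls of radius e/3 with the same centers are disjoint; their
    total measure is therefore at most exp(-(s - a) n) times a packing sum at
    exponent a. If the packing sums stayed bounded, Borel-Cantelli would make E
    negligible (finite_packing_limit_negligible). Hence every countable cover of E has a
    piece of infinite packing measure, and the packing pressure of E is at
    least s. For the upper local pressure this gives the inequality with the
    packing pressure of Z. For the two other pressures of mu that inequality
    follows by testing their defining infima on Z itself.

    Lower bounds. Let s < t < P, with s not negative and P the packing pressure
    of Z, and choose the scale e so that Z is not negligible at exponent t.
    Removing from Z all its relatively open negligible parts leaves the support
    of Z, near each point of which the packing sums at exponent s are
    unbounded (large_packing). This allows a tree of balls to be grown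
    (exists_children): the children of a ball are finitely many balls,
    the closed ones disjoint, centered in the support and near the center of the
    parent, whose weights add up to at least the weight of the parent. To each
    ball is attached an interval of parameters whose length is a fixed multiple
    of its weight; the intervals of the children then cover that of the parent.
    A parameter in [0, 1] thus selects a branch, the centers along the branch
    converge, and the image of Lebesgue measure under this limit map is a
    probability measure on Z (tree_measure). Because balls of one level stay
    apart (level_separated), a Bowen ball around a point of the limit set is
    only reached by parameters of one interval, so its measure is at most a
    constant times its weight, and all upper local rates are at least s.

    The limit map replaces the usual weak limit of atomic measures. The
    intervals of the children may reach beyond that of the parent, since only
    covering matters; this is why the packing sums need a lower bound alone.
    The upper local pressure is integrated as a possibly nonmeasurable function:
    the integral of the positive part is a supremum over simple functions, which
    is controlled from both sides by constants. The lower bound needs s to be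
    nonnegative, and this is where the hypothesis that P exceeds the norm of f
    enters. *)

(** * One-sided limits and upper limits *)

Section right_limits.
Context (R : realType).

Lemma lim_at_right0_sup (h : R -> \bar R) :
    (forall d e : R, 0 < d -> d <= e -> (h e <= h d)%E) ->
  lim (h e @[e --> 0^'+]) = ereal_sup (h @` [set e | 0 < e]).
Proof.
move=> hni; apply: cvg_lim => //.
have -> : [set e : R | 0 < e] = [set` Interval (BRight 0) +oo%O].
  by apply/seteqP; split=> e /=; rewrite in_itv/= andbT.
apply: nonincreasing_at_right_cvge => // d e.
by rewrite !in_itv/= !andbT => d0 _ /hni; apply.
Qed.

Lemma lim_lim_at_right0_sup (h : R -> R -> \bar R) :
    (forall d e d' e' : R, d <= d' -> e <= e' -> (h e' d' <= h e d)%E) ->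
  lim (lim (h e d @[d --> 0^'+]) @[e --> 0^'+]) =
  ereal_sup [set ereal_sup [set h e d | d in [set d | 0 < d]] | e in [set e | 0 < e]].
Proof.
move=> hni.
have inner : (fun e => lim (h e d @[d --> 0^'+])) =
    (fun e => ereal_sup [set h e d | d in [set d | 0 < d]]).
  by apply/funext => e; rewrite lim_at_right0_sup// => d d' _ dd'; exact: hni.
rewrite inner; apply: lim_at_right0_sup => d e _ de.
apply: ge_ereal_sup => _ [c /= c0 <-]; apply: (le_trans (hni _ _ _ _ (lexx c) de)).
by apply: ereal_sup_ubound; exists c.
Qed.

Lemma lt_limn_esup (u : (\bar R)^nat) (s : \bar R) (N : nat) :
  (s < limn_esup u)%E -> exists2 n, (N <= n)%N & (s < u n)%E.
Proof.
rewrite limn_esup_lim (cvg_lim _ (@cvg_esups_inf _ u))// => su.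
have : (s < ereal_sup (sdrop u N))%E.
  by rewrite (lt_le_trans su)//; apply: ereal_inf_lbound; exists N.
by move=> /ereal_sup_gt[_ [n /= Nn <-] sun]; exists n.
Qed.

Lemma limn_esup_ge (u : (\bar R)^nat) (s : \bar R) :
    (forall N : nat, exists2 n, (N <= n)%N & (s <= u n)%E) ->
  (s <= limn_esup u)%E.
Proof.
move=> su; rewrite limn_esup_lim (cvg_lim _ (@cvg_esups_inf _ u))//.
apply: le_ereal_inf_tmp => _ [N _ <-].
have [n Nn sun] := su N.
by rewrite (le_trans sun)//; apply: ereal_sup_ubound; exists n.
Qed.

Lemma le_limn_esup (u v : (\bar R)^nat) :
  (forall n, u n <= v n)%E -> (limn_esup u <= limn_esup v)%E.
Proof.
move=> uv; rewrite !limn_esup_lim; apply: lee_lim; try exact: is_cvg_esups.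
apply: nearW => n; apply: ge_ereal_sup => _ [k nk <-].
by rewrite (le_trans (uv k))//; apply: ereal_sup_ubound; exists k.
Qed.

End right_limits.

Lemma negligible_setC d (T : measurableType d) (R : realType)
    (P : probability T R) (A : set T) :
  measurable A -> P A = 1%E -> P.-negligible (~` A).
Proof.
move=> mA PA; apply/negligibleP; first exact: measurableC.
have : P (~` A) = 0%E by rewrite probability_setC// PA subee.
by [].
Qed.

Lemma near_forall_seq (T : Type) (I : eqType) (F : set_system T) (FF : Filter F)
    (P : I -> T -> Prop) (s : seq I) :
    (forall i, i \in s -> \forall t \near F, P i t) ->
  \forall t \near F, forall i, i \in s -> P i t.
Proof.
elim: s => [|i s IHs] hP; first by apply: nearW => t i; rewrite in_nil.
have hs : \forall t \near F, forall j, j \in s -> P j t.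
  by apply: IHs => j js; apply: hP; rewrite inE js orbT.
have hi := hP i (mem_head _ _).
apply: filterS2 hi hs => t Pi Ps j; rewrite inE => /orP[/eqP->//|]; exact: Ps.
Qed.

(** * Bowen metrics *)

Section bowen_metric.
Context (R : realType) (G : groupType) (X : pMetricType R).
Variable act : G -> X -> X.
Implicit Types (A : {fset G}) (x y z : X) (e : R).

Lemma bowen_dist_ge A x y g :
  g \in A -> mdist (act g x) (act g y) <= bowen_dist act A x y.
Proof.
by move=> gA; apply: (@le_bigmax_seq _ _ _ _ 0 g xpredT
  (fun g => mdist (act g x) (act g y)) gA).
Qed.

Lemma bowen_dist_le A x y e : 0 <= e ->
  (forall g, g \in A -> mdist (act g x) (act g y) <= e) ->
  bowen_dist act A x y <= e.
Proof.
by move=> e0 h; rewrite /bowen_dist big_seq; apply: bigmax_le => // g /h.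
Qed.

Lemma bowen_dist_lt A x y e : 0 < e ->
  (forall g, g \in A -> mdist (act g x) (act g y) < e) ->
  bowen_dist act A x y < e.
Proof.
by move=> e0 h; rewrite /bowen_dist big_seq; apply: bigmax_lt => // g /h.
Qed.

Lemma bowen_dist_ge0 A x y : 0 <= bowen_dist act A x y.
Proof. exact: bigmax_ge_id. Qed.

Lemma bowen_distxx A x : bowen_dist act A x x = 0.
Proof.
apply/eqP; rewrite eq_le bowen_dist_ge0 andbT.
by apply: bowen_dist_le => // g _; rewrite mdistxx.
Qed.

Lemma bowen_dist_sym A x y : bowen_dist act A x y = bowen_dist act A y x.
Proof. by apply: eq_bigr => g _; rewrite metric_sym. Qed.

Lemma bowen_dist_triangle A x y z :
  bowen_dist act A x z <= bowen_dist act A x y + bowen_dist act A y z.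
Proof.
apply: bowen_dist_le => [|g gA]; first by rewrite addr_ge0 ?bowen_dist_ge0.
by rewrite (le_trans (metric_triangle _ (act g y) _))// lerD ?bowen_dist_ge.
Qed.

Lemma bowen_dist_subset A B x y :
  {subset A <= B} -> bowen_dist act A x y <= bowen_dist act B x y.
Proof.
move=> AB; apply: bowen_dist_le => [|g /AB gB]; first exact: bowen_dist_ge0.
exact: bowen_dist_ge.
Qed.

Hypothesis act_continuous : forall g, continuous (act g).

Lemma near_bowen_dist A x e : 0 < e -> \forall y \near x, bowen_dist act A x y < e.
Proof.
move=> e0.
have : \forall y \near x, forall g, g \in A -> mdist (act g x) (act g y) < e.
  apply: near_forall_seq => g _.
  by apply: metricType_numDomainType.cvgr_dist_lt e0; exact: act_continuous.
by apply: filterS => y; exact: bowen_dist_lt.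
Qed.

Lemma open_bowen_ball A x e : open (bowen_ball act A x e).
Proof.
rewrite openE => y /= xye.
have : 0 < e - bowen_dist act A x y by rewrite subr_gt0.
move=> /(near_bowen_dist A y); apply: filterS => z yz /=.
rewrite /bowen_ball/= (le_lt_trans (bowen_dist_triangle _ _ y _))//.
by rewrite -ltrBrDl.
Qed.

Lemma near_birkhoff_sum (f : X -> R) A x e : continuous f -> 0 < e ->
  \forall y \near x, birkhoff_sum act f A x <= birkhoff_sum act f A y + e.
Proof.
move=> cf e0; have : continuous_at x (birkhoff_sum act f A).
  rewrite /birkhoff_sum; elim: (enum_fset A) => [|g s IHs].
    rewrite [X in continuous_at _ X](_ : _ = cst 0); first exact: cst_continuous.
    by apply/funext => y; rewrite big_nil.
  rewrite [X in continuous_at _ X](_ : _ = (f \o act g) +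
      (fun y => \sum_(h <- s) f (act h y))); last first.
    by apply/funext => y; rewrite big_cons.
  apply: continuousD => //.
  by apply: (@continuous_comp _ _ _ (act g) f); [exact: act_continuous|exact: cf].
move=> /cvgr_dist_lt/(_ e e0); apply: filterS => y.
by rewrite ltr_norml => /andP[_]; rewrite ltrBlDr addrC => /ltW.
Qed.

End bowen_metric.

(** * Packings by closed Bowen balls *)

Section packing.
Context (R : realType) (G : groupType) (X : pMetricType R).
Context (act : G -> X -> X) (F : nat -> {fset G}) (f : X -> R) (b : nat -> R).
Implicit Types (e a : R) (Z : set X).

Definition ball_weight a n x : R :=
  expR (- a * b #|` F n| + birkhoff_sum act f (F n) x).

Local Notation packing_N := (packing_N act F f b).
Local Notation packing_limit := (packing_limit act F f b).
Local Notation packing_outer := (packing_outer act F f b).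
Local Notation packing_pressure_at := (packing_pressure_at act F f b).

Lemma packing_N_ge0 N a e Z : (0 <= packing_N N a e Z)%E.
Proof.
apply: ereal_sup_ubound; exists set0, (fun=> point), id; split.
  by split => // i j [].
by rewrite /packing_sum esum_set0.
Qed.

Lemma packing_N_antitone a e Z : nonincreasing_seq (fun N => packing_N N a e Z).
Proof.
move=> M N MN; apply: ereal_sup_le => _ [D [x [n [[h t] ->]]]].
exists D, x, n; split => //; split => // i /h[Zx Nn]; split => //.
exact: leq_trans Nn.
Qed.

Lemma packing_limitE a e Z :
  packing_limit a e Z = ereal_inf (range (fun N => packing_N N a e Z)).
Proof.
by apply: cvg_lim => //; apply: ereal_nonincreasing_cvgn; exact: packing_N_antitone.
Qed.

Lemma packing_limit_ge0 a e Z : (0 <= packing_limit a e Z)%E.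
Proof.
rewrite packing_limitE; apply: le_ereal_inf_tmp => _ [N _ <-].
exact: packing_N_ge0.
Qed.

Lemma packing_limit_le N a e Z : (packing_limit a e Z <= packing_N N a e Z)%E.
Proof. by rewrite packing_limitE; apply: ereal_inf_lbound; exists N. Qed.

Lemma subset_packing_limit a e Y Z : Y `<=` Z ->
  (packing_limit a e Y <= packing_limit a e Z)%E.
Proof.
move=> YZ; rewrite [leRHS]packing_limitE; apply: le_ereal_inf_tmp => _ [N _ <-].
apply: (le_trans (packing_limit_le N _ _ _)).
apply: ereal_sup_le => _ [D [x [n [[h t] ->]]]].
by exists D, x, n; split => //; split => // i /h[/YZ Zx Nn].
Qed.

Lemma packing_limit_radius_antitone a e d Z : d <= e ->
  (packing_limit a e Z <= packing_limit a d Z)%E.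
Proof.
move=> de; rewrite [leRHS]packing_limitE; apply: le_ereal_inf_tmp => _ [N _ <-].
apply: (le_trans (packing_limit_le N _ _ _)).
apply: ereal_sup_le => _ [D [x [n [[h t] ->]]]].
exists D, x, n; split => //; split => // i j Di Dj [y [yi yj]].
apply: t => //; exists y; split; rewrite /bowen_cball/=.
  exact: le_trans de.
exact: le_trans de.
Qed.

Lemma packing_limit_series_ge0 a e (Zs : (set X)^nat) :
  (0 <= \sum_(0 <= i <oo) packing_limit a e (Zs i))%E.
Proof. by apply: nneseries_ge0 => i _ _; exact: packing_limit_ge0. Qed.

Lemma packing_outer_ge0 a e Z : (0 <= packing_outer a e Z)%E.
Proof.
by apply: le_ereal_inf_tmp => _ [Zs _ <-]; exact: packing_limit_series_ge0.
Qed.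

Lemma packing_pressure_at_antitone d e Z : d <= e ->
  (packing_pressure_at e Z <= packing_pressure_at d Z)%E.
Proof.
move=> de; apply: ereal_inf_le_tmp => _ [a /= a0 <-]; exists a => //=.
apply/eqP; rewrite eq_le packing_outer_ge0 andbT -a0.
apply: le_ereal_inf_tmp => _ [Zs ZZs <-].
apply: (@le_trans _ _ (\sum_(0 <= i <oo) packing_limit a e (Zs i))%E).
  by apply: ereal_inf_lbound; exists Zs.
apply: lee_nneseries => i _; first by move=> _; exact: packing_limit_ge0.
exact: packing_limit_radius_antitone.
Qed.

Lemma packing_limit0 a e : packing_limit a e set0 = 0%E.
Proof.
apply/eqP; rewrite eq_le packing_limit_ge0 andbT.
apply: (le_trans (packing_limit_le 0 _ _ _)).
apply: ge_ereal_sup => _ [D [x [n [[h t] ->]]]].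
by rewrite /packing_sum esum1// => i /h[].
Qed.

Hypothesis act_continuous : forall g, continuous (act g).
Hypothesis X_compact : compact [set: X].

(** Points of a cover by balls of radius e/2 are kept one at a time, each only
    when it is not yet within e of those already kept. *)
Lemma finite_separated_net (A : {fset G}) (E : set X) (e : R) : 0 < e ->
  exists xs : seq X, [/\ forall x, x \in xs -> E x,
    pairwise (fun x y => e <= bowen_dist act A x y) xs &
    forall y, E y -> exists2 x, x \in xs & bowen_ball act A x e y].
Proof.
move=> e0; have e20 : 0 < e / 2 by rewrite divr_gt0.
have : cover_compact [set: X] by rewrite -compact_cover.
move=> /(_ X setT (fun c => bowen_ball act A c (e / 2))) [].
- by move=> c _; exact: open_bowen_ball.
- by move=> x _; exists x => //; rewrite /bowen_ball/= bowen_distxx.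
move=> cs _ cov.
suff [xs [xsE xse xscov]] : exists xs : seq X, [/\ forall x, x \in xs -> E x,
    pairwise (fun x y => e <= bowen_dist act A x y) xs &
    forall c y, c \in enum_fset cs -> bowen_dist act A c y < e / 2 -> E y ->
      exists2 x, x \in xs & bowen_ball act A x e y].
  exists xs; split => // y Ey.
  by have [c /= ccs cy] := cov y Logic.I; exact: (xscov c).
elim: (enum_fset cs) => [|c s [xs [xsE xse xscov]]]; first by exists [::].
have [[y [cy Ey yxs]]|far] := pselect (exists y, [/\ bowen_dist act A c y < e / 2,
    E y & forall x, x \in xs -> e <= bowen_dist act A y x]).
  exists (y :: xs); split.
  - by move=> x; rewrite inE => /orP[/eqP->//|]; exact: xsE.
  - by rewrite pairwise_cons xse andbT; apply/allP.
  - move=> d z; rewrite inE => /orP[/eqP->|ds] dz Ez.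
      exists y; first exact: mem_head.
      rewrite /bowen_ball/= (le_lt_trans (bowen_dist_triangle _ _ _ c _))//.
      by rewrite [ltRHS]splitr ltrD// bowen_dist_sym.
    have [x xxs xz] := xscov d z ds dz Ez.
    by exists x => //; rewrite inE xxs orbT.
exists xs; split => // d z; rewrite inE => /orP[/eqP->|ds] dz Ez; last first.
  exact: (xscov d).
apply: contrapT => nx; apply: far; exists z; split => // x xxs.
rewrite leNgt; apply/negP => zx; apply: nx; exists x => //.
by rewrite /bowen_ball/= bowen_dist_sym.
Qed.

(** At distance at least e, balls of radius e/3 cannot meet. *)
Lemma packing_N_ge_seq N n a e Z (xs : seq X) : 0 < e -> (N <= n)%N ->
    (forall x, x \in xs -> Z x) ->
    pairwise (fun x y => e <= bowen_dist act (F n) x y) xs ->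
  ((\sum_(x <- xs) ball_weight a n x)%:E <= packing_N N a (e / 3) Z)%E.
Proof.
move=> e0 Nn xsZ xse; apply: ereal_sup_ubound.
exists `I_(size xs), (nth point xs), (fun=> n); split; last first.
  rewrite /packing_sum esum_fset; [|exact: finite_II|
    by move=> i _; rewrite lee_fin expR_ge0].
  rewrite -(fsbig_ord _ _ (fun i => (ball_weight a n (nth point xs i))%:E)).
  by rewrite (big_nth point) big_mkord sumEFin.
split=> [i /= ixs|]; first by split => //; apply: xsZ; rewrite mem_nth.
have sep i j : (i < j < size xs)%N ->
    e <= bowen_dist act (F n) (nth point xs i) (nth point xs j).
  move=> /andP[ij jxs]; move/(pairwiseP point): xse; apply => //.
  by rewrite inE (ltn_trans ij).
have disj i j : (i < j < size xs)%N ->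
    ~ ((bowen_cball act (F n) (nth point xs i) (e / 3) `&`
        bowen_cball act (F n) (nth point xs j) (e / 3)) !=set0).
  move=> /sep ije [y [/= iy jy]].
  have := le_trans ije (bowen_dist_triangle _ _ _ y _).
  rewrite /bowen_cball/= in iy jy; rewrite [bowen_dist _ _ y _]bowen_dist_sym.
  by lra.
move=> i j /= ixs jxs ijy; have [ij|ji|//] := ltngtP i j.
- by exfalso; apply: (disj i j) => //; rewrite ij.
- by exfalso; apply: (disj j i); [rewrite ji|rewrite setIC].
Qed.

End packing.

(** * Small balls force large packings *)

(** The rate inequality solved for the measure of the ball; a null ball, of
    infinite rate, satisfies it trivially. *)
Lemma lt_local_rate (R : realType) (m : \bar R) (B c s : R) :
    0 < B -> (0 <= m)%E -> (s%:E < (- lne m + c%:E) / B%:E)%E ->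
  (m <= (expR (- s * B + c))%:E)%E.
Proof.
move=> B0; case: m => [r| |]// r0; last first.
  by rewrite /= inver gt_eqF// addNye gt0_mulNye ?lte_fin ?invr_gt0.
have [r_le0 _|r_gt0] := leP r 0; first by rewrite lee_fin (le_trans r_le0)// expR_ge0.
rewrite lne_EFin// inver gt_eqF// -EFinN -EFinD -EFinM lte_fin.
rewrite ltr_pdivlMr// => h.
by rewrite lee_fin -[leLHS]lnK ?posrE// ler_expR; lra.
Qed.

(** The converse, with a factor K that is lost in the limit as B grows. *)
Lemma ge_local_rate (R : realType) (m : \bar R) (B c s K : R) :
    0 < B -> 0 < K -> (0 <= m)%E -> (m <= (K * expR (- s * B + c))%:E)%E ->
  ((s - ln K / B)%:E <= (- lne m + c%:E) / B%:E)%E.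
Proof.
move=> B0 K0; case: m => [r| |]// r0.
have [r_le0 _|r_gt0] := leP r 0.
  by rewrite le0_lneNy// inver gt_eqF//= addye// gt0_mulye ?lte_fin ?invr_gt0// leey.
rewrite lne_EFin// inver gt_eqF// -EFinN -EFinD -EFinM !lee_fin.
rewrite -ler_ln ?posrE ?mulr_gt0 ?expR_gt0// lnM ?posrE ?expR_gt0// expRK => h.
rewrite ler_pdivlMr// mulrBl divfK ?gt_eqF//.
by lra.
Qed.

Section strictly_increasing.
Context (G : groupType) (F : nat -> {fset G}).
Hypothesis F_increasing : strictly_increasing F.

Lemma strictly_increasing_subset m n : (m <= n)%N -> {subset F m <= F n}.
Proof.
move=> mn; apply/fsubsetP; move: m n mn.
apply: (@homo_leq _ F (fun A B : {fset G} => (A `<=` B)%fset)).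
- exact: fsubset_refl.
- by move=> B A C; exact: fsubset_trans.
- by move=> n; apply: fproper_sub; exact: F_increasing.
Qed.

Lemma strictly_increasing_card n : (n <= #|` F n|)%N.
Proof.
elim: n => // n IHn; apply: leq_ltn_trans IHn _.
by apply: fproper_ltn_card; exact: F_increasing.
Qed.

End strictly_increasing.

Lemma open_borel_measurable (T : ptopologicalType) (A : set T) :
  open A -> measurable (A : set (borel T)).
Proof. by move=> oA; apply: sub_sigma_algebra. Qed.

Lemma closed_borel_measurable (T : ptopologicalType) (A : set T) :
  closed A -> measurable (A : set (borel T)).
Proof.
move=> cA; rewrite -[A]setCK; apply: measurableC.
by apply: open_borel_measurable; exact: closed_openC.
Qed.

Section packing_of_measure.
Context (R : realType) (G : groupType) (X : pMetricType R).
Context (act : G -> X -> X) (F : nat -> {fset G}) (f : X -> R) (b : nat -> R).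
Hypothesis act_continuous : forall g, continuous (act g).
Hypothesis X_compact : compact [set: X].
Hypothesis F_increasing : strictly_increasing F.
Hypothesis b_gt0 : forall n, 0 < b n.
Hypothesis b_ge : forall n : nat, #|` F n|%:R <= b #|` F n|.
Context (mu : probability (borel X) R).

Definition local_rate (e : R) (x : X) (n : nat) : \bar R :=
  ((- lne (mu (bowen_ball act (F n) x e)) + (birkhoff_sum act f (F n) x)%:E)
     / (b #|` F n|)%:E)%E.

Lemma scale_ge_index n : n%:R <= b #|` F n|.
Proof. by rewrite (le_trans _ (b_ge n))// ler_nat strictly_increasing_card. Qed.

(** At time n the points of rate above s lie in a finite union U n of balls; its
    measure is at most C q^n, where C bounds the packing sums at exponent a and
    q = exp(-(s - a)) < 1. Every point of E lies in infinitely many of the U n,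
    so Borel-Cantelli applies. *)
Lemma finite_packing_limit_negligible (s a e : R) (E : set X) :
    0 < e -> a < s -> (forall x, E x -> (s%:E < limn_esup (local_rate e x))%E) ->
    (packing_limit act F f b a (e / 3) E < +oo)%E ->
  mu.-negligible (E : set (borel X)).
Proof.
move=> e0 as_ Es; rewrite packing_limitE => /ereal_inf_lt[_ [N _ <-] PN].
have PNfin : packing_N act F f b N a (e / 3) E \is a fin_num.
  by rewrite ge0_fin_numE// packing_N_ge0.
set C := fine (packing_N act F f b N a (e / 3) E) in PNfin.
have C0 : 0 <= C by rewrite fine_ge0// packing_N_ge0.
pose q := expR (- (s - a)).
have q0 : 0 < q by exact: expR_gt0.
have q1 : q < 1 by rewrite expR_lt1 oppr_lt0 subr_gt0.
pose En n := [set y | E y /\ (s%:E < local_rate e y n)%E].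
have /choice[xs xsP] n :=
  finite_separated_net act_continuous X_compact (F n) (En n) e0.
pose U n : set (borel X) := if (N <= n)%N then
  \bigcup_(i in `I_(size (xs n))) bowen_ball act (F n) (nth point (xs n) i) e
  else set0.
have mball n x : measurable (bowen_ball act (F n) x e : set (borel X)).
  by apply: open_borel_measurable; exact: open_bowen_ball.
have mU n : measurable (U n).
  by rewrite /U; case: ifP => // _; apply: fin_bigcup_measurable.
have muU n : (mu (U n) <= (geometric C q n)%:E)%E.
  rewrite /U; case: ifPn => [Nn|_]; last first.
    by rewrite measure0 lee_fin mulr_ge0// exprn_ge0// ltW.
  have [xsE xse _] := xsP n.
  apply: (@le_trans _ _ (\sum_(x <- xs n) mu (bowen_ball act (F n) x e))%E).
    rewrite (big_nth point) big_mkord (fsbig_ord _ _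
      (fun i => mu (bowen_ball act (F n) (nth point (xs n) i) e))).
    by apply: content_sub_fsum => //; exact: fin_bigcup_measurable.
  apply: (@le_trans _ _ (\sum_(x <- xs n) (q ^+ n * ball_weight act F f b a n x)%:E)%E).
    rewrite big_seq [leRHS]big_seq; apply: lee_sum => x /xsE[_ rx].
    (* The gap s - a of exponents gains exp(-(s - a) B), and B is at least n. *)
    have /= := lt_local_rate (b_gt0 _) (measure_ge0 _ _) rx.
    move=> /le_trans; apply; rewrite lee_fin /ball_weight /q -expRM_natl -expRD.
    rewrite ler_expR.
    have := scale_ge_index n; set B := b _; set c := birkhoff_sum _ _ _ _.
    move=> nB; rewrite -subr_ge0.
    have -> : n%:R * - (s - a) + (- a * B + c) - (- s * B + c) = (s - a) * (B - n%:R).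
      by ring.
    by rewrite mulr_ge0// subr_ge0// ltW.
  rewrite sumEFin -mulr_sumr mulrC EFinM [leRHS]EFinM lee_pmul2r ?lte_fin ?exprn_gt0//.
  rewrite /C fineK//.
  by apply: packing_N_ge_seq => // x /xsE[].
have muU_summable : (\sum_(n <oo) mu (U n) < +oo)%E.
  apply: (@le_lt_trans _ _ (C / (1 - q))%:E); last exact: ltry.
  apply: lime_le; first by apply: is_cvg_nneseries => n _ _; exact: measure_ge0.
  apply: nearW => n.
  apply: (@le_trans _ _ (\sum_(0 <= i < n) (geometric C q i)%:E)%E).
    by apply: lee_sum => i _.
  rewrite sumEFin lee_fin; apply: geometric_le_lim => //.
  by rewrite gtr0_norm.
exists (lim_sup_set U); split.
- apply: bigcap_measurableType => n _.
  by apply: bigcup_measurable => k _; exact: mU.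
- exact: lim_sup_set_cvg0.
- move=> x Ex M _; have [n Mn sn] := lt_limn_esup (maxn M N) (Es x Ex).
  exists n; first by rewrite /= (leq_trans (leq_maxl _ _) Mn).
  rewrite /U (leq_trans (leq_maxr _ _) Mn).
  have [_ _ /(_ x (conj Ex sn))[y yxs xy]] := xsP n.
  by exists (index y (xs n)); rewrite /= ?index_mem// nth_index.
Qed.

Lemma packing_series_pinfty (s a e : R) (E : set X) (Zs : (set X)^nat) :
    0 < e -> a < s -> (forall x, E x -> (s%:E < limn_esup (local_rate e x))%E) ->
    ~ mu.-negligible (E `&` \bigcup_i Zs i : set (borel X)) ->
  (\sum_(0 <= i <oo) packing_limit act F f b a (e / 3) (Zs i) = +oo)%E.
Proof.
move=> e0 as_ Es nneg.
have [i inf] : exists i, packing_limit act F f b a (e / 3) (Zs i) = +oo%E.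
  apply: contrapT => fin; apply: nneg; rewrite setI_bigcupr.
  apply: (@negligible_bigcup _ _ _ mu (fun i => E `&` Zs i)) => i.
  apply: (finite_packing_limit_negligible e0 as_) => [x [Ex _]|]; first exact: Es.
  apply: (@le_lt_trans _ _ (packing_limit act F f b a (e / 3) (Zs i))).
    by apply: subset_packing_limit => x [].
  by rewrite ltey; apply/eqP => inf; apply: fin; exists i.
apply/eqP; rewrite -leye_eq (@nneseriesD1 _ _ i)//; last first.
  by move=> k _; exact: packing_limit_ge0.
by rewrite inf leeDl//; apply: nneseries_ge0 => k _ _; exact: packing_limit_ge0.
Qed.

End packing_of_measure.

(** * Pressures of a measure against the packing pressure *)

Section pressure_bounds.
Context (R : realType) (G : groupType) (X : pMetricType R).
Context (act : G -> X -> X) (F : nat -> {fset G}) (f : X -> R) (b : nat -> R).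
Hypothesis act_continuous : forall g, continuous (act g).
Hypothesis X_compact : compact [set: X].
Hypothesis F_increasing : strictly_increasing F.
Hypothesis b_gt0 : forall n, 0 < b n.
Hypothesis b_ge : forall n : nat, #|` F n|%:R <= b #|` F n|.
Context (mu : probability (borel X) R).

Local Notation rate := (local_rate act F f b mu).
Local Notation packing_outer := (packing_outer act F f b).
Local Notation packing_pressure_at := (packing_pressure_at act F f b).
Local Notation packing_pressure := (packing_pressure act F f b).

Lemma local_rate_antitone (d e : R) x n : d <= e -> (rate e x n <= rate d x n)%E.
Proof.
move=> de; rewrite /local_rate lee_pmul2r; last first.
- by rewrite inver gt_eqF// lte_fin invr_gt0.
- by rewrite inver gt_eqF.
have m0 (e' : R) : mu (bowen_ball act (F n) x e') \in `[0, +oo]%E.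
  by rewrite in_itv/= measure_ge0 leey.
rewrite leeD2r// leeN2 lee_lne// le_measure ?inE//;
  try by apply: open_borel_measurable; exact: open_bowen_ball.
by move=> y; rewrite /bowen_ball/= => /lt_le_trans; apply.
Qed.

Lemma limn_esup_local_rate_antitone (d e : R) x : d <= e ->
  (limn_esup (rate e x) <= limn_esup (rate d x))%E.
Proof. by move=> de; apply: le_limn_esup => n; exact: local_rate_antitone. Qed.

Lemma upper_local_pressureE x : upper_local_pressure act F f b mu x =
  ereal_sup [set limn_esup (rate e x) | e in [set e | 0 < e]].
Proof.
apply: lim_at_right0_sup => d e _; exact: limn_esup_local_rate_antitone.
Qed.

Lemma packing_pressureE Z : packing_pressure Z =
  ereal_sup [set packing_pressure_at e Z | e in [set e | 0 < e]].
Proof.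
apply: lim_at_right0_sup => d e _; exact: packing_pressure_at_antitone.
Qed.

Lemma packing_pressure_at_le (e : R) Z : 0 < e ->
  (packing_pressure_at e Z <= packing_pressure Z)%E.
Proof.
by move=> e0; rewrite packing_pressureE; apply: ereal_sup_ubound; exists e.
Qed.

(** Below s, every countable cover of Y has an infinite packing sum, so no
    exponent below s competes in the infimum. *)
Lemma packing_pressure_at_ge (s e : R) (E Y : set X) :
    0 < e -> (forall x, E x -> (s%:E <= limn_esup (rate e x))%E) ->
    ~ mu.-negligible (E `&` Y : set (borel X)) ->
  (s%:E <= packing_pressure_at (e / 3) Y)%E.
Proof.
move=> e0 Es nneg; apply: le_ereal_inf_tmp => _ [a /= a0 <-].
rewrite lee_fin leNgt; apply/negP => a_s.
suff : (+oo <= packing_outer a (e / 3) Y)%E by rewrite a0.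
apply: le_ereal_inf_tmp => _ [Zs /= YZs <-].
rewrite (@packing_series_pinfty _ _ _ _ _ f b act_continuous X_compact
  F_increasing b_gt0 b_ge mu ((a + s) / 2) a e E)//.
- by rewrite midf_lt.
- move=> x /Es; apply: lt_le_trans; rewrite lte_fin midf_lt//.
- by apply: contra_not nneg; apply: negligibleS => x [Ex /YZs Zx].
Qed.

Local Notation katok_at := (katok_packing_pressure_at act F f b mu).
Local Notation katok_outer := (katok_packing_outer act F f b mu).

Lemma katok_packing_pressure_at_ge (s e d : R) (E : set X) :
    0 < e -> (forall x, E x -> (s%:E <= limn_esup (rate e x))%E) ->
    (forall Y : set (borel X), measurable Y -> ((1 - d)%:E <= mu Y)%E ->
       ~ mu.-negligible (E `&` Y : set (borel X))) ->
  (s%:E <= katok_at (e / 3) d)%E.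
Proof.
move=> e0 Es nneg; apply: le_ereal_inf_tmp => _ [a /= a0 <-].
rewrite lee_fin leNgt; apply/negP => a_s.
suff : (+oo <= katok_outer a (e / 3) d)%E by rewrite a0.
apply: le_ereal_inf_tmp => _ [Zs /= [mZs Zsd] <-].
rewrite (@packing_series_pinfty _ _ _ _ _ f b act_continuous X_compact
  F_increasing b_gt0 b_ge mu ((a + s) / 2) a e E)//.
- by rewrite midf_lt.
- move=> x /Es; apply: lt_le_trans; rewrite lte_fin midf_lt//.
- exact: nneg.
Qed.

Lemma katok_packing_outer_ge0 (a e d : R) : (0 <= katok_outer a e d)%E.
Proof.
by apply: le_ereal_inf_tmp => _ [Zs _ <-]; exact: packing_limit_series_ge0.
Qed.

Lemma katok_packing_pressure_at_antitone (d e d' e' : R) : d <= d' -> e <= e' ->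
  (katok_at e' d' <= katok_at e d)%E.
Proof.
move=> dd' ee'; apply: ereal_inf_le_tmp => _ [a /= a0 <-]; exists a => //=.
apply/eqP; rewrite eq_le katok_packing_outer_ge0 andbT -a0.
apply: le_ereal_inf_tmp => _ [Zs [mZs Zsd] <-].
apply: (@le_trans _ _ (\sum_(0 <= i <oo) packing_limit act F f b a e' (Zs i))%E).
  apply: ereal_inf_lbound; exists Zs => //; split => //.
  by apply: le_trans Zsd; rewrite lee_fin lerB.
apply: lee_nneseries => i _; first by move=> _; exact: packing_limit_ge0.
exact: packing_limit_radius_antitone.
Qed.

Definition measure_packing_pressure_at (e d : R) : \bar R :=
  ereal_inf [set packing_pressure_at e Y
            | Y in [set Y : set (borel X) | measurable Y /\
                      ((1 - d)%:E <= mu Y)%E]].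

Lemma measure_packing_pressure_at_antitone (d e d' e' : R) :
    d <= d' -> e <= e' ->
  (measure_packing_pressure_at e' d' <= measure_packing_pressure_at e d)%E.
Proof.
move=> dd' ee'; apply: le_ereal_inf_tmp => _ [Y [mY Yd] <-].
apply: le_trans (packing_pressure_at_antitone _ _ _ _ Y ee').
apply: ereal_inf_lbound; exists Y => //; split => //.
by apply: le_trans Yd; rewrite lee_fin lerB.
Qed.

Lemma measure_packing_pressureE : measure_packing_pressure act F f b mu =
  ereal_sup [set ereal_sup [set measure_packing_pressure_at e d
    | d in [set d | 0 < d]] | e in [set e | 0 < e]].
Proof.
exact: (lim_lim_at_right0_sup measure_packing_pressure_at_antitone).
Qed.

Lemma katok_packing_pressureE : katok_packing_pressure act F f b mu =
  ereal_sup [set ereal_sup [set katok_at e d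
    | d in [set d | 0 < d]] | e in [set e | 0 < e]].
Proof.
exact: (lim_lim_at_right0_sup katok_packing_pressure_at_antitone).
Qed.

Section upper_bounds.
Context (Z : set X).
Hypothesis Z_closed : closed Z.
Hypothesis mu_Z : mu Z = 1%E.

Lemma measure_packing_pressure_le :
  (measure_packing_pressure act F f b mu <= packing_pressure Z)%E.
Proof.
rewrite measure_packing_pressureE; apply: ge_ereal_sup => _ [e /= e0 <-].
apply: ge_ereal_sup => _ [d /= d0 <-].
apply: le_trans (packing_pressure_at_le Z e0).
apply: ereal_inf_lbound; exists Z => //; split.
  exact: closed_borel_measurable.
by rewrite mu_Z lee_fin gerBl ltW.
Qed.

Lemma katok_packing_pressure_le :
  (katok_packing_pressure act F f b mu <= packing_pressure Z)%E.
Proof.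
rewrite katok_packing_pressureE; apply: ge_ereal_sup => _ [e /= e0 <-].
apply: ge_ereal_sup => _ [d /= d0 <-].
apply: le_trans (packing_pressure_at_le Z e0).
apply: ereal_inf_le_tmp => _ [a /= a0 <-]; exists a => //=.
apply/eqP; rewrite eq_le katok_packing_outer_ge0 andbT -a0.
apply: le_ereal_inf_tmp => _ [Zs /= ZZs <-].
(* A cover of Z need not have a measurable union; its trace on Z does. *)
apply: (@le_trans _ _ (\sum_(0 <= i <oo) packing_limit act F f b a e (Zs i `&` Z))%E).
  apply: ereal_inf_lbound; exists (fun i => Zs i `&` Z) => //=.
  rewrite -setI_bigcupl (setIidr ZZs); split.
    exact: closed_borel_measurable.
  by rewrite mu_Z lee_fin gerBl ltW.
apply: lee_nneseries => i _; first by move=> _; exact: packing_limit_ge0.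
by apply: subset_packing_limit => x [].
Qed.

(** If the upper local pressure exceeded s on a nonnegligible set, some fixed
    scale 1/(k+1) would already witness it on a nonnegligible part of Z, and the
    packing pressure of Z would be at least s. *)
Lemma upper_local_pressure_le_ae (s : R) : (packing_pressure Z < s%:E)%E ->
  mu.-negligible
    ([set x | (s%:E < upper_local_pressure act F f b mu x)%E] : set (borel X)).
Proof.
move=> Ps.
pose E k : set (borel X) := [set x | (s%:E <= limn_esup (rate k.+1%:R^-1 x))%E].
have ZC : mu.-negligible (~` Z : set (borel X)).
  by apply: negligible_setC => //; exact: closed_borel_measurable.
apply: (@negligibleS _ _ _ mu (~` Z `|` \bigcup_k (E k `&` Z))) => [x|].
  rewrite /= upper_local_pressureE => /ereal_sup_gt[_ [e /= e0 <-] se].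
  have [Zx|] := pselect (Z x); last by left.
  have [k] := ltr_add_invr e0; rewrite add0r => ke.
  right; exists k => //; split => //.
  by apply: (le_trans (ltW se)); apply: limn_esup_local_rate_antitone; exact: ltW.
apply: negligibleU => //; apply: negligible_bigcup => k.
apply: contrapT => nneg; move: Ps; rewrite ltNge => /negP; apply.
have k0 : 0 < k.+1%:R^-1 :> R by rewrite invr_gt0.
apply: (le_trans (@packing_pressure_at_ge s k.+1%:R^-1 (E k) Z k0 _ nneg)) => //.
by apply: packing_pressure_at_le; rewrite divr_gt0.
Qed.

End upper_bounds.

Section lower_bounds.
Context (s e : R) (K : set X).
Hypothesis e_gt0 : 0 < e.
Hypothesis K_measurable : measurable (K : set (borel X)).
Hypothesis mu_K : mu K = 1%E.
Hypothesis K_rate : forall x, K x -> (s%:E <= limn_esup (rate e x))%E.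

Lemma upper_local_pressure_ge x : K x ->
  (s%:E <= upper_local_pressure act F f b mu x)%E.
Proof.
move=> /K_rate; rewrite upper_local_pressureE => /le_trans; apply.
by apply: ereal_sup_ubound; exists e.
Qed.

Lemma full_measure_meets (d : R) (Y : set (borel X)) : d < 1 ->
  measurable Y -> ((1 - d)%:E <= mu Y)%E ->
  ~ mu.-negligible (K `&` Y : set (borel X)).
Proof.
move=> d1 mY Yd KY.
have KC : mu.-negligible (~` K : set (borel X)) by exact: negligible_setC.
have /negligibleP : mu.-negligible Y.
  apply: negligibleS (negligibleU KC KY) => x Yx.
  by have [|] := pselect (K x); [right|left].
by move=> /(_ mY) Y0; move: Yd; rewrite Y0 lee_fin subr_le0 leNgt d1.
Qed.

Lemma katok_packing_pressure_ge :
  (s%:E <= katok_packing_pressure act F f b mu)%E.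
Proof.
rewrite katok_packing_pressureE.
apply: (@le_trans _ _ (katok_at (e / 3) 2^-1)).
  apply: katok_packing_pressure_at_ge e_gt0 K_rate _ => Y.
  by apply: full_measure_meets; rewrite invf_lt1// ltr1n.
apply: (@le_trans _ _ (ereal_sup [set katok_at (e / 3) d | d in [set d | 0 < d]])).
  by apply: ereal_sup_ubound; exists 2^-1 => //=.
by apply: ereal_sup_ubound; exists (e / 3) => //=; rewrite divr_gt0.
Qed.

Lemma measure_packing_pressure_ge :
  (s%:E <= measure_packing_pressure act F f b mu)%E.
Proof.
rewrite measure_packing_pressureE.
apply: (@le_trans _ _ (measure_packing_pressure_at (e / 3) 2^-1)).
  apply: le_ereal_inf_tmp => _ [Y [mY Yd] <-].
  apply: packing_pressure_at_ge e_gt0 K_rate _.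
  by apply: full_measure_meets mY Yd; rewrite invf_lt1// ltr1n.
apply: (@le_trans _ _
  (ereal_sup [set measure_packing_pressure_at (e / 3) d | d in [set d | 0 < d]])).
  by apply: ereal_sup_ubound; exists 2^-1 => //=.
by apply: ereal_sup_ubound; exists (e / 3) => //=; rewrite divr_gt0.
Qed.

End lower_bounds.

End pressure_bounds.

(** * Integrals compared with a constant *)

Section lower_integral.
Context d (T : measurableType d) (R : realType) (mu : probability T R).
Implicit Types (f : T -> \bar R) (s : R).

Import HBNNSimple.

(** The integral of a nonnegative function, measurable or not, is the supremum of
    the integrals of the simple functions below it. *)
Lemma ge0_integral_le_cst f s : (forall x, 0 <= f x)%E -> 0 <= s ->
    mu.-negligible [set x | (s%:E < f x)%E] ->
  (\int[mu]_x f x <= s%:E)%E.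
Proof.
move=> f0 s0 fs; rewrite ge0_integralTE//; apply: ge_ereal_sup => _ [h /= hf <-].
have -> : (s%:E = \int[mu]_x (cst s%:E) x)%E.
  transitivity (s%:E * mu setT)%E; first by rewrite probability_setT mule1.
  by rewrite integral_cst.
rewrite -integralT_nnsfun.
apply: ae_ge0_le_integral => //.
- by move=> x _; rewrite lee_fin.
- exact/measurable_EFinP.
- apply: negligibleS fs => x /= /existsNP[_ /negP]; rewrite -ltNge => sh.
  exact: lt_le_trans (hf x).
Qed.

Lemma integral_le_cst f s : 0 <= s ->
    mu.-negligible [set x | (s%:E < f x)%E] ->
  (\int[mu]_x f x <= s%:E)%E.
Proof.
move=> s0 fs; rewrite integralE.
apply: (@le_trans _ _ (\int[mu]_x f^\+ x)%E).
  by rewrite geeDl// oppe_le0; apply: integral_ge0 => x _.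
apply: ge0_integral_le_cst => //; apply: negligibleS fs => x /=.
rewrite funeposE lt_max => /orP[//|].
by rewrite (_ : 0%R = 0%:E)%E// lte_fin ltNge s0.
Qed.

Lemma integral_ge_cst f s (K : set T) : 0 <= s -> measurable K ->
    mu K = 1%E -> (forall x, K x -> (s%:E <= f x)%E) ->
  (s%:E <= \int[mu]_x f x)%E.
Proof.
move=> s0 mK muK Ks; rewrite integralE.
have -> : (\int[mu]_x f^\- x = 0)%E.
  apply/eqP; rewrite eq_le integral_ge0// andbT.
  apply: ge0_integral_le_cst => //; apply: (@negligibleS _ _ _ mu (~` K)).
    move=> x /= + Kx; have fx0 : (0 <= f x)%E.
      by rewrite (le_trans _ (Ks x Kx))// lee_fin.
    by rewrite funenegE (max_idPr _) ?ltxx// oppe_le0.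
  exact: negligible_setC.
rewrite sube0 ge0_integralTE//; apply: ereal_sup_ubound.
exists (scale_nnsfun (indic_nnsfun R mK) s0) => /=.
  move=> x; rewrite mindicE; have [/set_mem/Ks|_] := boolP (x \in K).
    by rewrite mulr1 funeposE le_max => ->.
  by rewrite mulr0 funepos_ge0.
by rewrite sintegralrM sintegral_indic// [X in (_ * X)%E](_ : _ = 1%E)// mule1.
Qed.

End lower_integral.

(** * A measure carried by the limit set of a tree *)

Section closed_mdist.
Context (R : realType) (X : metricType R).

Lemma near_mdist (x : X) (e : R) : 0 < e -> \forall y \near x, mdist x y < e.
Proof.
by move=> e0; near=> y; have : ball x e y; [near: y; exact: nbhsx_ballx|
  rewrite ballEmdist].
Unshelve. all: by end_near. Qed.

Lemma closed_mdist_le (x : X) (r : R) : closed [set y | mdist x y <= r].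
Proof.
rewrite -[X in closed X]setCK; apply: open_closedC.
rewrite openE => y /= /negP; rewrite -ltNge => ry.
have : 0 < mdist x y - r by rewrite subr_gt0.
move=> /(near_mdist y); apply: filterS => z yz /=.
apply/negP; rewrite -ltNge.
have := metric_triangle x z y; rewrite [mdist z y]metric_sym.
by lra.
Qed.

End closed_mdist.

Section uniform_measure.
Context (R : realType).

Let unit_itv : set (measurableTypeR R) := [set` `[0, 1]].

Let measurable_unit_itv : measurable unit_itv.
Proof. exact: measurable_itv. Qed.

Definition unit_measure : set (measurableTypeR R) -> \bar R :=
  mrestr lebesgue_measure measurable_unit_itv.

HB.instance Definition _ := Measure.copy unit_measure
  (mrestr lebesgue_measure measurable_unit_itv).

Let unit_measure_setT : unit_measure setT = 1%E.
Proof.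
by rewrite /unit_measure /mrestr setTI lebesgue_measure_itv/= lte_fin ltr01 sube0.
Qed.

HB.instance Definition _ :=
  Measure_isProbability.Build _ _ _ unit_measure unit_measure_setT.

Lemma unit_measure_le (A : set (measurableTypeR R)) (a l : R) :
    measurable A -> 0 <= l ->
    (forall t, 0 <= t <= 1 -> A t -> a <= t < a + l) ->
  (unit_measure A <= l%:E)%E.
Proof.
move=> mA l0 Al; apply: (@le_trans _ _ (lebesgue_measure [set` `[a, a + l[])).
  apply: le_measure; rewrite ?inE//; first exact: measurableI.
  by move=> t [At]; rewrite /unit_itv/= !in_itv/= => t01; exact: Al.
rewrite lebesgue_measure_itv/= lte_fin; case: ifP => _; last by rewrite lee_fin.
by rewrite -EFinB addrAC subrr add0r.
Qed.

End uniform_measure.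

(** The tree is abstract: a node carries a point, a radius and an interval of
    parameters, and its children refine the first two and cover the third. *)
Section tree_measure.
Context (R : realType) (X : pMetricType R) (N : choiceType).
Context (pt : N -> X) (rad lo len : N -> R) (ch : N -> seq N) (root : N).
Context (valid : N -> Prop).

Definition interval_of (u : N) : pred R := fun t => lo u <= t < lo u + len u.

Definition level (i : nat) : seq N :=
  iter i (fun s => flatten (map ch s)) [:: root].

(** The default child is only reached by parameters outside the interval of u. *)
Definition descend (t : R) (u : N) : N :=
  head (head u (ch u)) [seq v <- ch u | interval_of v t].

Definition branch (t : R) (i : nat) : N := iter i (descend t) root.

Hypothesis X_compact : compact [set: X].
Hypothesis valid_root : valid root.
Hypothesis valid_ch : forall u v, valid u -> v \in ch u -> valid v.
Hypothesis ch_neq0 : forall u, valid u -> ch u != [::].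
Hypothesis rad_gt0 : forall u, valid u -> 0 < rad u.
Hypothesis len_ge0 : forall u, valid u -> 0 <= len u.
Hypothesis ch_near : forall u v, valid u -> v \in ch u ->
  mdist (pt u) (pt v) <= rad u / 4.
Hypothesis ch_rad : forall u v, valid u -> v \in ch u -> rad v <= rad u / 4.
Hypothesis interval_root : forall t, 0 <= t <= 1 -> interval_of root t.
Hypothesis interval_ch : forall u t, valid u -> interval_of u t ->
  has (fun v => interval_of v t) (ch u).

Lemma level_valid i u : u \in level i -> valid u.
Proof.
elim: i u => [|i IHi] u /=; first by rewrite inE => /eqP->.
by move=> /flattenP[_ /mapP[w /IHi vw ->]]; exact: valid_ch.
Qed.

Lemma level_child i v : v \in level i.+1 -> exists2 u, u \in level i & v \in ch u.
Proof. by move=> /flattenP[_ /mapP[u ui ->] vu]; exists u. Qed.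

Lemma rad_level i u : u \in level i -> rad u <= rad root * 4^-1 ^+ i.
Proof.
elim: i u => [|i IHi] u; first by rewrite inE => /eqP->; rewrite expr0 mulr1.
move=> /level_child[w wi uw].
have := IHi _ wi; have := ch_rad (level_valid wi) uw; rewrite exprS mulrCA.
by lra.
Qed.

Lemma descend_in t u : valid u -> descend t u \in ch u.
Proof.
move=> vu; rewrite /descend.
case E : [seq v <- ch u | interval_of v t] => [|w s] /=.
  by case: (ch u) (ch_neq0 vu) => //= w s _; exact: mem_head.
by have : w \in w :: s by [exact: mem_head]; rewrite -E mem_filter => /andP[].
Qed.

Lemma descend_interval t u : valid u -> interval_of u t -> interval_of (descend t u) t.
Proof.
move=> vu /(interval_ch vu); rewrite has_filter /descend.
case E : [seq v <- ch u | interval_of v t] => [//|w s] /= _.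
by have : w \in w :: s by [exact: mem_head]; rewrite -E mem_filter => /andP[].
Qed.

Lemma branch_level t i : branch t i \in level i.
Proof.
elim: i => [|i IHi]; first exact: mem_head.
apply/flattenP; exists (ch (branch t i)); first exact: map_f.
by apply: descend_in; exact: level_valid IHi.
Qed.

Lemma branch_valid t i : valid (branch t i).
Proof. exact: level_valid (branch_level t i). Qed.

Lemma branch_interval t i : 0 <= t <= 1 -> interval_of (branch t i) t.
Proof.
move=> t01; elim: i => [|i IHi]; first exact: interval_root.
exact: descend_interval (branch_valid _ _) IHi.
Qed.

Lemma measurable_branch i (A : set N) : measurable [set t : R | A (branch t i)].
Proof.
have mcst (P : Prop) : measurable [set t : R | P].
  have [p|np] := pselect P.
    by rewrite (_ : [set _ | _] = setT)//; apply/seteqP; split.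
  by rewrite (_ : [set _ | _] = set0)//; apply/seteqP; split.
have mitv u : measurable [set t : R | interval_of u t].
  have -> : [set t | interval_of u t] = [set` `[lo u, lo u + len u[].
    by apply/seteqP; split => t /=; rewrite in_itv.
  exact: measurable_itv.
have mhead (B : set N) d s :
    measurable [set t : R | B (head d [seq v <- s | interval_of v t])].
  elim: s d => [|v s IHs] d; first exact: (mcst (B d)).
  rewrite (_ : [set t | _] = ([set t | interval_of v t] `&` [set _ | B v]) `|`
      (~` [set t | interval_of v t] `&`
       [set t | B (head d [seq v <- s | interval_of v t])])).
    apply: measurableU; apply: measurableI => //.
    exact: measurableC.
  apply/seteqP; split => t /=.
    by case: ifP => vt ?; [left|right].
  by case: ifP => vt [[]|[]].
elim: i A => [|i IHi] A; first exact: (mcst (A root)).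
rewrite (_ : [set t | _] = \bigcup_(u in [set` level i])
    ([set t | branch t i = u] `&` [set t | A (descend t u)])).
  apply: fin_bigcup_measurable => // u _; apply: measurableI.
    exact: (IHi [set u]).
  exact: mhead.
apply/seteqP; split => t /=.
  by move=> At; exists (branch t i) => //; exact: branch_level.
by move=> [u _ [<-]].
Qed.

Lemma branch_nested t i j : (i <= j)%N ->
  mdist (pt (branch t i)) (pt (branch t j)) + rad (branch t j) / 2
    <= rad (branch t i) / 2.
Proof.
move=> /subnK <-; elim: (j - i)%N => [|k IHk]; first by rewrite mdistxx add0r.
have vk := branch_valid t (k + i); have ck := descend_in t vk.
have := ch_near vk ck; have := ch_rad vk ck; have := rad_gt0 vk.
have := metric_triangle (pt (branch t i)) (pt (branch t (k + i)))
  (pt (branch t (k.+1 + i))).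
rewrite addSn /= -/(branch t (k + i)).
by lra.
Qed.

(** A cluster point of the centers lies in all the closed balls of the branch
    because these are nested. *)
Lemma branch_limit t :
  exists z, forall i, mdist (pt (branch t i)) z <= rad (branch t i) / 2.
Proof.
have [z [_ cz]] := X_compact (F := (fun j => pt (branch t j)) @ \oo) _ filterT.
exists z => i; rewrite leNgt; apply/negP => far.
have : 0 < mdist (pt (branch t i)) z - rad (branch t i) / 2 by rewrite subr_gt0.
move=> /(near_mdist z) nz.
have tl : ((fun j => pt (branch t j)) @ \oo)
    [set y | mdist (pt (branch t i)) y <= rad (branch t i) / 2].
  exists i => // j /= ij; have := branch_nested t ij.
  by have := rad_gt0 (branch_valid t j); lra.
have [y [/= iy zy]] := cz _ _ tl nz.
have := metric_triangle (pt (branch t i)) y z; rewrite [mdist y z]metric_sym.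
by lra.
Qed.

Definition tree_limit_set : set X :=
  [set z | forall i, exists2 u, u \in level i & mdist (pt u) z <= rad u / 2].

Lemma measurable_tree_limit_set : measurable (tree_limit_set : set (borel X)).
Proof.
rewrite (_ : tree_limit_set = \bigcap_i \bigcup_(u in [set` level i])
    [set z | mdist (pt u) z <= rad u / 2]); last first.
  by apply/seteqP; split => z h i; [move=> _; exact: h|exact: h].
apply: bigcap_measurableType => i _; apply: fin_bigcup_measurable => // u _.
by apply: closed_borel_measurable; exact: closed_mdist_le.
Qed.

Lemma tree_limit_set_subset (Z : set X) : closed Z ->
  (forall u, valid u -> Z (pt u)) -> tree_limit_set `<=` Z.
Proof.
move=> cZ Zpt z Kz; apply: cZ => B /nbhs_ballP[e /= e0 Be].
have : (rad root * 4^-1 ^+ i @[i --> \oo] --> rad root * 0).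
  apply: cvgMr; apply: cvg_expr; rewrite gtr0_norm ?invr_gt0// invf_lt1// ltr1n//.
rewrite mulr0 => /cvgr_lt/(_ e e0)[i _ /(_ i (leqnn _)) ie].
have [u ui uz] := Kz i.
exists (pt u); split; first exact: Zpt (level_valid ui).
apply: Be; rewrite ballEmdist/= metric_sym (le_lt_trans uz)//.
have := rad_level ui; have := rad_gt0 (level_valid ui); rewrite /= in ie.
by lra.
Qed.

(** The law of the limit point of the branch of a uniform parameter. A set that
    meets the half-size ball of only one node u of some level is reached only by
    parameters whose branch passes through u, and these lie in the interval
    of u. *)
Lemma tree_measure : exists mu : probability (borel X) R,
  mu tree_limit_set = 1%E /\
  forall i u (A : set (borel X)), u \in level i -> measurable A ->
    (forall v z, v \in level i -> mdist (pt v) z <= rad v / 2 -> A z -> v = u) ->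
  (mu A <= (len u)%:E)%E.
Proof.
have /choice[g gP] := branch_limit.
have mg : measurable_fun setT (g : measurableTypeR R -> borel X).
  (* The limit lies in C if and only if every center on the branch is within
     its radius of C, a condition on finitely many nodes at each level. *)
  have mclosed (C : set X) : closed C -> measurable (g @^-1` C).
    move=> cC.
    rewrite (_ : g @^-1` C = \bigcap_i [set t | exists2 c, C c &
        mdist (pt (branch t i)) c <= rad (branch t i)]).
      apply: bigcap_measurableType => i _.
      exact: (measurable_branch i [set u | exists2 c, C c & mdist (pt u) c <= rad u]).
    apply/seteqP; split => [t Cgt i _|t h].
      exists (g t) => //; have := gP t i; have := rad_gt0 (branch_valid t i).
      by lra.
    apply: cC => B /nbhs_ballP[e /= e0 Be].
    have : (rad root * 4^-1 ^+ i @[i --> \oo] --> rad root * 0).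
      apply: cvgMr; apply: cvg_expr; rewrite gtr0_norm ?invr_gt0// invf_lt1// ltr1n//.
    rewrite mulr0 => /cvgr_lt/(_ (e / 2)); rewrite divr_gt0// => /(_ isT).
    move=> [i _ /(_ i (leqnn _))/= ie].
    have [c Cc ic] := h i Logic.I.
    exists c; split=> //; apply: Be; rewrite ballEmdist/=.
    have := metric_triangle (g t) (pt (branch t i)) c.
    rewrite [mdist (g t) (pt _)]metric_sym.
    have := gP t i; have := rad_level (branch_level t i).
    have := rad_gt0 (branch_valid t i).
    by lra.
  apply: (@measurability _ _ (measurableTypeR R) (borel X) setT g (@open X)) => //.
  move=> _ [U oU <-]; rewrite setTI -[U]setCK preimage_setC.
  by apply: measurableC; apply: (mclosed (~` U)); exact: open_closedC.
exists (distribution (@unit_measure R) (mfun_Sub (mem_set mg))); split.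
  rewrite /distribution /pushforward/=.
  rewrite (_ : _ @^-1` _ = setT); first by rewrite probability_setT.
  apply/seteqP; split=> // t _ i; exists (branch t i); [exact: branch_level|exact: gP].
move=> i u A ui mA Au; rewrite /distribution /pushforward/=.
apply: (@unit_measure_le _ _ (lo u)).
- by rewrite -[X in measurable X]setTI; exact: mg.
- exact: len_ge0 (level_valid ui).
- move=> t t01 At; have <- : branch t i = u; last exact: branch_interval.
  exact: (Au _ (g t)) (branch_level t i) (gP t i) At.
Qed.

End tree_measure.

(** * Negligible sets and the support of the packing outer measure *)

Section packing_null.
Context (R : realType) (G : groupType) (X : pMetricType R).
Context (act : G -> X -> X) (F : nat -> {fset G}) (f : X -> R) (b : nat -> R).
Context (a e : R).
Implicit Types (A B Z : set X).

(** A form of vanishing packing outer measure that is stable under countable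
    unions without any summation. *)
Definition packing_null A : Prop := exists Zs : nat -> set X,
  A `<=` \bigcup_i Zs i /\ forall i, packing_limit act F f b a e (Zs i) = 0%E.

Lemma packing_nullS A B : A `<=` B -> packing_null B -> packing_null A.
Proof. by move=> AB [Zs [BZs Zs0]]; exists Zs; split => // x /AB/BZs. Qed.

Lemma packing_null_outer A : packing_null A -> packing_outer act F f b a e A = 0%E.
Proof.
move=> [Zs [AZs Zs0]]; apply/eqP; rewrite eq_le packing_outer_ge0 andbT.
by apply: ereal_inf_lbound; exists Zs => //; rewrite eseries0.
Qed.

Lemma packing_limit0_null A : packing_limit act F f b a e A = 0%E -> packing_null A.
Proof. by move=> A0; exists (fun=> A); split => // x Ax; exists 0%N. Qed.

Lemma packing_null0 : packing_null set0.
Proof. by apply: packing_limit0_null; exact: packing_limit0. Qed.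

Lemma packing_null_bigcup (A_ : nat -> set X) :
  (forall k, packing_null (A_ k)) -> packing_null (\bigcup_k A_ k).
Proof.
move=> /choice[Zs ZsP].
exists (fun n => if (choice.unpickle n : option (nat * nat)) is Some p
  then Zs p.1 p.2 else set0); split.
  move=> x [k _ Akx]; have [/(_ x Akx)[i _ Zx] _] := ZsP k.
  by exists (choice.pickle (k, i)) => //; rewrite choice.pickleK.
move=> n; case: (choice.unpickle n : option (nat * nat)) => [[k i]|];
  last exact: packing_limit0.
by have [_] := ZsP k.
Qed.

Lemma packing_nullU A B : packing_null A -> packing_null B -> packing_null (A `|` B).
Proof.
move=> A0 B0; rewrite -bigcup2E; apply: packing_null_bigcup => -[|[|k]] //=.
exact: packing_null0.
Qed.

Definition packing_support Z : set X :=
  [set x | Z x /\ forall r, 0 < r -> ~ packing_null (Z `&` [set y | mdist x y < r])].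

Hypothesis X_compact : compact [set: X].

Lemma finite_mdist_net (r : R) : 0 < r ->
  exists cs : seq X, forall x, exists2 c, c \in cs & mdist c x < r.
Proof.
move=> r0; have : cover_compact [set: X] by rewrite -compact_cover.
move=> /(_ X setT (fun c => [set y | mdist c y < r])) [].
- move=> c _; rewrite openE => y /= cy.
  have : 0 < r - mdist c y by rewrite subr_gt0.
  move=> /(near_mdist y); apply: filterS => z yz /=.
  by have := metric_triangle c y z; lra.
- by move=> x _; exists x => //=; rewrite mdistxx.
move=> cs _ cov; exists (enum_fset cs) => x.
by have [c /= ? ?] := cov x Logic.I; exists c.
Qed.

(** The removed part is covered by the negligible ones among countably many
    balls, taken from finite nets of radius 1/(k+1). *)
Lemma packing_null_setD_support Z : packing_null (Z `\` packing_support Z).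
Proof.
have rad_gt0 (k : nat) : 0 < k.+1%:R^-1 :> R by rewrite invr_gt0.
have /choice[cs csP] k := finite_mdist_net (rad_gt0 k).
pose T k j := Z `&` [set y | mdist (nth point (cs k) j) y < k.+1%:R^-1].
pose U k j := if `[< packing_null (T k j) >] then T k j else set0.
apply: (@packing_nullS _ (\bigcup_k \bigcup_j U k j)); last first.
  apply: packing_null_bigcup => k; apply: packing_null_bigcup => j.
  by rewrite /U; case: asboolP => // _; exact: packing_null0.
move=> x [Zx nsx].
have [r [r0 xr]] : exists r : R, 0 < r /\ packing_null (Z `&` [set y | mdist x y < r]).
  apply: contrapT => h; apply: nsx; split => // r r0 xr; apply: h; by exists r.
have r20 : 0 < r / 2 by rewrite divr_gt0.
have [k] := ltr_add_invr r20; rewrite add0r => kr.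
have [c cin cx] := csP k x.
exists k => //; exists (index c (cs k)) => //.
have Tx : T k (index c (cs k)) x by split => //=; rewrite nth_index.
rewrite /U; case: asboolP => // -[]; apply: packing_nullS xr => y [Zy /= cy].
split => //=; rewrite nth_index// in cy.
have := metric_triangle x c y; rewrite [mdist x c]metric_sym.
by move: (k.+1%:R^-1 : R) kr cx cy => q; lra.
Qed.

(** Being nonnegligible passes from Z near x to the support near x, since the
    rest of Z is negligible; this makes the construction below repeatable. *)
Lemma packing_support_gt0 Z x (r : R) : packing_support Z x -> 0 < r ->
  (0 < packing_limit act F f b a e
         (packing_support Z `&` [set y | (mdist x y < r)%R]))%E.
Proof.
move=> [Zx nsx] r0; rewrite lt_neqAle packing_limit_ge0 andbT eq_sym.
apply/eqP => /packing_limit0_null s0; apply: (nsx r r0).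
apply: packing_nullS (packing_nullU s0 (packing_null_setD_support Z)).
move=> y [Zy xy]; have [sy|nsy] := pselect (packing_support Z y); by [left|right].
Qed.

Lemma packing_support_neq0 Z : packing_outer act F f b a e Z <> 0%E ->
  packing_support Z !=set0.
Proof.
move=> Z0; apply: contrapT => s0; apply: Z0; apply: packing_null_outer.
apply: packing_nullS (packing_null_setD_support Z) => x Zx; split=> // sx.
by apply: s0; exists x.
Qed.

End packing_null.

Section large_packing.
Context (R : realType) (G : groupType) (X : pMetricType R).
Context (act : G -> X -> X) (F : nat -> {fset G}) (f : X -> R) (b : nat -> R).
Hypothesis F_increasing : strictly_increasing F.
Hypothesis b_ge : forall n : nat, #|` F n|%:R <= b #|` F n|.

(** Passing from exponent t to s < t multiplies the weight of a ball of index n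
    by at least exp((t - s) n), so a lower bound c on the packing sums at t
    becomes an arbitrarily large one at s, already for a finite packing. *)
Lemma large_packing (s t e : R) (A : set X) (N : nat) (w : R) :
    s < t -> 0 < e -> (0 < packing_limit act F f b t e A)%E ->
  exists ps : seq (X * nat), [/\ uniq ps,
    forall p, p \in ps -> A p.1 /\ (N <= p.2)%N,
    forall p q, p \in ps -> q \in ps -> p != q ->
      e < bowen_dist act (F p.2) p.1 q.1 &
    w <= \sum_(p <- ps) ball_weight act F f b s p.2 p.1].
Proof.
move=> st e0 A0.
have [c c0 cA] : exists2 c : R, 0 < c & (c%:E < packing_limit act F f b t e A)%E.
  move: A0; case: packing_limit => [r| |]//; rewrite ?lte_fin => r0.
    by exists (r / 2); rewrite ?lte_fin ?divr_gt0// ltr_pdivrMr// ltr_pMr// ltr1n.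
  by exists 1 => //; rewrite ltry.
(* N' makes c exp((t - s) N') at least w, through exp x >= 1 + x. *)
pose N' := maxn N (Num.truncn ((t - s)^-1 * (c^-1 * w))).+1.
have ts0 : 0 < t - s by rewrite subr_gt0.
have wN' : w <= c * expR ((t - s) * N'%:R).
  rewrite -ler_pdivrMl//.
  apply: le_trans (expR_ge1Dx _); rewrite -[leLHS]add0r lerD//.
  rewrite -ler_pdivrMl//; apply/ltW.
  by rewrite (lt_le_trans (truncnS_gt _))// ler_nat leq_maxr.
have := lt_le_trans cA (packing_limit_le act F f b N' t e A).
move=> /ereal_sup_gt[_ [D [x [n [[Dx Dt] ->]]]] ].
move=> /ereal_sup_gt[_ [B [finB BD] <-] cB].
have B_D i : i \in fset_set B -> D i by rewrite in_fset_set// inE => /BD.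
have disj i j : i \in fset_set B -> j \in fset_set B -> i != j ->
    e < bowen_dist act (F (n i)) (x i) (x j).
  move=> /B_D Di /B_D Dj ij; rewrite ltNge; apply/negP => ije.
  move/eqP: ij; apply; apply: Dt => //; exists (x j); split => //.
  by rewrite /bowen_cball/= bowen_distxx ltW.
pose pair i := (x i, n i).
have pair_inj : {in fset_set B &, injective pair}.
  move=> i j iB jB /= [xij nij]; apply/eqP; apply: contrapT => /negP ij.
  by have := disj i j iB jB ij; rewrite xij bowen_distxx ltNge ltW.
exists [seq pair i | i <- fset_set B]; split.
- by rewrite map_inj_in_uniq ?fset_uniq.
- move=> p /mapP[i /B_D /Dx[Ax Nn] ->]; split => //.
  by rewrite (leq_trans _ Nn)// leq_maxl.
- move=> p q /mapP[i iB ->] /mapP[j jB ->] ij; apply: disj => //.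
  by apply: contra_neq ij => ->.
- rewrite big_map (le_trans wN')//.
  rewrite fsbig_finite//= sumEFin lte_fin in cB.
  apply: (@le_trans _ _ ((\sum_(i <- fset_set B) ball_weight act F f b t (n i) (x i)) *
      expR ((t - s) * N'%:R))).
    by rewrite ler_wpM2r ?expR_ge0// ltW.
  rewrite mulr_suml big_seq [leRHS]big_seq; apply: ler_sum => i /B_D /Dx[_ Nn].
  rewrite /ball_weight -expRD ler_expR.
  have : N'%:R <= b #|` F (n i)|.
    by rewrite (le_trans _ (scale_ge_index F_increasing b_ge _))// ler_nat.
  move=> /(ler_wpM2l (ltW ts0)); rewrite !mulrBl !mulNr.
  by set u := birkhoff_sum _ _ _ _; lra.
Qed.

End large_packing.

(** * A measure with uniformly small Bowen balls *)

Lemma map_uniq_inj (S T : eqType) (h : S -> T) (s : seq S) :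
  uniq (map h s) -> {in s &, injective h}.
Proof.
elim: s => //= x s IHs /andP[hx /IHs inj] u v; rewrite !inE.
move=> /orP[/eqP->|us] /orP[/eqP->|vs] //; last exact: inj.
- by move=> xv; move: hx; rewrite xv map_f.
- by move=> ux; move: hx; rewrite -ux map_f.
Qed.

Section separation.
Context (R : realType) (G : groupType) (X : pMetricType R).
Context (act : G -> X -> X) (f : X -> R).
Hypothesis act_continuous : forall g, continuous (act g).
Hypothesis f_continuous : continuous f.

Lemma near0_birkhoff_sum (A : {fset G}) (x : X) :
  \forall r \near (0 : R)^'+, forall z, mdist x z <= r ->
    birkhoff_sum act f A x <= birkhoff_sum act f A z + 1.
Proof.
apply/(@metricType_numDomainType.nbhsr0P R X
  (fun z => birkhoff_sum act f A x <= birkhoff_sum act f A z + 1)).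
exact: near_birkhoff_sum.
Qed.

Lemma near0_bowen_separated (A : {fset G}) (x y : X) (e : R) :
    e < bowen_dist act A x y ->
  \forall r \near (0 : R)^'+, forall z w, mdist x z <= r -> mdist y w <= r ->
    e <= bowen_dist act A z w.
Proof.
move=> exy; have d0 : 0 < (bowen_dist act A x y - e) / 2.
  by rewrite divr_gt0// subr_gt0.
have near_x u := @metricType_numDomainType.nbhsr0P R X
  (fun z => bowen_dist act A u z < (bowen_dist act A x y - e) / 2) u.
have nx := (near_x x).1 (near_bowen_dist act_continuous A x d0).
have ny := (near_x y).1 (near_bowen_dist act_continuous A y d0).
apply: filterS2 nx ny => r xr yr z w xz yw.
have := xr z xz; have := yr w yw.
have := bowen_dist_triangle act A x z y; have := bowen_dist_triangle act A z w y.
by rewrite [bowen_dist act A w y]bowen_dist_sym; lra.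
Qed.

End separation.

Section uniform_measure_on_packing.
Context (R : realType) (G : groupType) (X : pMetricType R).
Context (act : G -> X -> X) (F : nat -> {fset G}) (f : X -> R) (b : nat -> R).
Hypothesis act_continuous : forall g, continuous (act g).
Hypothesis f_continuous : continuous f.
Hypothesis X_compact : compact [set: X].
Hypothesis F_increasing : strictly_increasing F.
Hypothesis b_gt0 : forall n, 0 < b n.
Hypothesis b_ge : forall n : nat, #|` F n|%:R <= b #|` F n|.
Context (s t e : R) (Z : set X).
Hypothesis st : s < t.
Hypothesis e_gt0 : 0 < e.
Hypothesis Z_closed : closed Z.

Local Notation weight := (ball_weight act F f b s).
Local Notation bowen n := (bowen_dist act (F n)).
Local Notation support := (packing_support act F f b t e Z).

(** A node is a center, an index n standing for the ball of F n, a radius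
    bounding the region in which its descendants live, and the left end of its
    interval of parameters. *)
Definition node : choiceType := (X * nat * R * R)%type.
Definition node_center (u : node) : X := u.1.1.1.
Definition node_index (u : node) : nat := u.1.1.2.
Definition node_radius (u : node) : R := u.1.2.
Definition node_left (u : node) : R := u.2.
Definition node_weight (u : node) : R := weight (node_index u) (node_center u).

(** The last condition lets the weight of the ball be bounded, up to a factor
    exp 1, by the weight at any point of the region of the node. *)
Definition valid_node (u : node) : Prop :=
  [/\ support (node_center u), 0 < node_radius u &
      forall z, mdist (node_center u) z <= node_radius u ->
        birkhoff_sum act f (F (node_index u)) (node_center u)
          <= birkhoff_sum act f (F (node_index u)) z + 1].

Context (C : R).
Hypothesis C_gt0 : 0 < C.

Definition node_length (u : node) : R := C * node_weight u.

Lemma node_length_gt0 u : 0 < node_length u.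
Proof. by rewrite mulr_gt0// expR_gt0. Qed.

Local Notation in_interval := (interval_of node_left node_length).

Fixpoint consecutive_nodes (r a : R) (ps : seq (X * nat)) : seq node :=
  if ps is p :: ps' then
    (p, r, a) :: consecutive_nodes r (a + C * weight p.2 p.1) ps'
  else [::].

Lemma consecutive_nodesP r a ps :
  map (fun u : node => u.1.1) (consecutive_nodes r a ps) = ps.
Proof. by elim: ps a => //= p ps IHps a; rewrite IHps. Qed.

Lemma consecutive_nodes_radius r a ps u :
  u \in consecutive_nodes r a ps -> u.1.1 \in ps /\ node_radius u = r.
Proof.
elim: ps a => //= p ps IHps a; rewrite !inE => /orP[/eqP->|/IHps[ups ru]].
  by rewrite eqxx.
by rewrite ups orbT.
Qed.

Lemma consecutive_nodes_cover r a ps (x : R) :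
    a <= x < a + C * \sum_(p <- ps) weight p.2 p.1 ->
  has (fun v => in_interval v x) (consecutive_nodes r a ps).
Proof.
elim: ps a => [|p ps IHps] a; rewrite ?big_nil ?big_cons.
  by rewrite mulr0 addr0 => /andP[/le_lt_trans h /h]; rewrite ltxx.
move=> /andP[ax xa] /=; apply/orP.
have [xp|px] := ltP x (a + C * weight p.2 p.1); [left|right].
  by rewrite /interval_of /node_left/= ax xp.
by apply: IHps; rewrite px -addrA -mulrDr.
Qed.

(** Children refine their parent as in the abstract tree. The last condition
    keeps the regions of siblings apart in the Bowen metric of either one. *)
Definition children (u : node) (vs : seq node) : Prop :=
  [/\ forall v, v \in vs -> [/\ valid_node v,
        mdist (node_center u) (node_center v) <= node_radius u / 4,
        node_radius v <= node_radius u / 4 & (node_index u < node_index v)%N],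
      forall x, in_interval u x -> has (fun v => in_interval v x) vs &
      forall v w, v \in vs -> w \in vs -> v != w ->
        forall y z, mdist (node_center v) y <= node_radius v ->
          mdist (node_center w) z <= node_radius w -> e <= bowen (node_index v) y z].

(** A large packing near the center of u, with all radii shrunk to a common r
    that keeps the finitely many closed Bowen balls apart and f nearly constant. *)
Lemma exists_children u : valid_node u -> exists vs, children u vs.
Proof.
move=> [su ru fu]; have ru4 : 0 < node_radius u / 4 by rewrite divr_gt0.
have [ps [ps_uniq psA ps_sep ps_w]] := large_packing F_increasing b_ge
  (node_index u).+1 (node_weight u) st e_gt0 (packing_support_gt0 X_compact su ru4).
pose near_const p r := forall z, mdist p.1 z <= r ->
  birkhoff_sum act f (F p.2) p.1 <= birkhoff_sum act f (F p.2) z + 1.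
pose separated p q r := p != q ->
  forall y z, mdist p.1 y <= r -> mdist q.1 z <= r -> e <= bowen p.2 y z.
have rf : \forall r \near (0 : R)^'+, forall p, p \in ps -> near_const p r.
  by apply: (@near_forall_seq _ _ _ _ near_const) => p _; exact: near0_birkhoff_sum.
have rsep : \forall r \near (0 : R)^'+,
    forall p, p \in ps -> forall q, q \in ps -> separated p q r.
  apply: (@near_forall_seq _ _ _ _
    (fun p r => forall q, q \in ps -> separated p q r)).
  move=> p pps; apply: (@near_forall_seq _ _ _ _ (separated p)) => q qps.
  have [->|pq] := eqVneq p q; first by apply: nearW => r; rewrite /separated eqxx.
  have sep := near0_bowen_separated act_continuous (ps_sep p q pps qps pq).
  by apply: filterS sep => r h _.
have [r [[r0 ru4r] [{}rf {}rsep]]] := @filter_ex _ (0 : R)^'+ _ _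
  (filterI (filterI (nbhs_right_gt 0) (nbhs_right_le ru4)) (filterI rf rsep)).
exists (consecutive_nodes r (node_left u) ps); split.
- move=> v /consecutive_nodes_radius[vps rv]; have [[sv uv] iv] := psA _ vps.
  split; rewrite ?rv//; last exact: ltW.
  by split; rewrite ?rv//; exact: rf.
- move=> x /andP[ux xu]; apply: consecutive_nodes_cover; rewrite ux/=.
  by rewrite (lt_le_trans xu)// lerD2l ler_pM2l.
- move=> v w vvs wvs vw y z.
  have [vps rv] := consecutive_nodes_radius vvs.
  have [wps rw] := consecutive_nodes_radius wvs.
  rewrite rv rw; apply: rsep => //; apply: contra_neq vw.
  apply: (map_uniq_inj (h := fun u : node => u.1.1)
    (s := consecutive_nodes r (node_left u) ps)) => //.
  by rewrite consecutive_nodesP.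
Qed.

Context (ch : node -> seq node) (root : node).
Hypothesis chP : forall u, valid_node u -> children u (ch u).
Hypothesis valid_root : valid_node root.
Hypothesis root_interval : forall x, 0 <= x <= 1 -> in_interval root x.

Local Notation level := (level ch root).

Let valid_ch u v : valid_node u -> v \in ch u -> valid_node v.
Proof. by move=> /chP[h _ _] /h[]. Qed.

Let valid_level i u : u \in level i -> valid_node u.
Proof. exact: (level_valid valid_root valid_ch). Qed.

Let ch_neq0 u : valid_node u -> ch u != [::].
Proof.
move=> /chP[_ h _]; have /h : in_interval u (node_left u).
  by rewrite /interval_of lexx/= ltrDl node_length_gt0.
by case: (ch u).
Qed.

Let ch_near u v : valid_node u -> v \in ch u ->
  mdist (node_center u) (node_center v) <= node_radius u / 4.
Proof. by move=> /chP[h _ _] /h[]. Qed.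

Let ch_radius u v : valid_node u -> v \in ch u -> node_radius v <= node_radius u / 4.
Proof. by move=> /chP[h _ _] /h[]. Qed.

Let ch_interval u x : valid_node u -> in_interval u x ->
  has (fun v => in_interval v x) (ch u).
Proof. by move=> /chP[_ h _]; exact: h. Qed.

Let radius_gt0 u : valid_node u -> 0 < node_radius u.
Proof. by case. Qed.

Lemma level_index i u : u \in level i -> (i <= node_index u)%N.
Proof.
elim: i u => // i IHi u /level_child[w wi uw].
have [/(_ u uw)[_ _ _ wu] _ _] := chP (valid_level wi).
exact: leq_ltn_trans (IHi w wi) wu.
Qed.

(** Two nodes of one level are first told apart among siblings; passing to
    descendants shrinks the region and enlarges the Bowen metric. *)
Lemma level_separated i u v y z : u \in level i -> v \in level i -> u != v ->
    mdist (node_center u) y <= node_radius u / 2 ->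
    mdist (node_center v) z <= node_radius v / 2 ->
  e <= bowen (node_index u) y z.
Proof.
elim: i u v y z => [|i IHi] u v y z.
  by rewrite !inE => /eqP-> /eqP->; rewrite eqxx.
move=> /level_child[u' u'i uu'] /level_child[v' v'i vv'] uv uy vz.
have vu' := valid_level u'i; have vv'v := valid_level v'i.
have ru := radius_gt0 (valid_ch vu' uu'); have rv := radius_gt0 (valid_ch vv'v vv').
have [u'v'|u'v'] := eqVneq u' v'.
  have [_ _ sep] := chP vu'; apply: (sep u v) => //; first by rewrite u'v'.
  - by rewrite (le_trans uy)//; lra.
  - by rewrite (le_trans vz)//; lra.
apply: (@le_trans _ _ (bowen (node_index u') y z)).
  apply: (IHi u' v') => //.
  - have := ch_near vu' uu'; have := ch_radius vu' uu'.
    by have := metric_triangle (node_center u') (node_center u) y; lra.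
  - have := ch_near vv'v vv'; have := ch_radius vv'v vv'.
    by have := metric_triangle (node_center v') (node_center v) z; lra.
apply: bowen_dist_subset; apply: strictly_increasing_subset => //.
by have [/(_ u uu')[_ _ _ /ltnW]] := chP vu'.
Qed.

(** By separation the ball of index n around a limit point z meets one region of
    its level only, so its measure is at most C times the weight of a ball
    centered within the region of z: the rate is at least s up to a term of
    order 1/B. *)
Lemma tree_measure_local_rate : exists (mu : probability (borel X) R) (K : set X),
  [/\ measurable (K : set (borel X)), K `<=` Z, mu K = 1%E &
      forall z, K z -> (s%:E <= limn_esup (local_rate act F f b mu e z))%E].
Proof.
have [mu [muK mu_le]] := tree_measure X_compact valid_root valid_ch ch_neq0
  radius_gt0 (fun u _ => ltW (node_length_gt0 u)) ch_near ch_radius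
  root_interval ch_interval.
exists mu, (tree_limit_set node_center node_radius ch root); split => //.
- exact: measurable_tree_limit_set.
- apply: (tree_limit_set_subset valid_root valid_ch radius_gt0 ch_radius Z_closed).
  by move=> u [[]].
move=> z Kz; apply/lee_subgt0Pr => d d0; rewrite -EFinB; apply: limn_esup_ge => N.
pose L := ln (C * expR 1); pose i := maxn N (Num.truncn (L / d)).+1.
have [u ui uz] := Kz i; have [_ ru fu] := valid_level ui.
have iu := level_index ui.
exists (node_index u); first by rewrite (leq_trans _ iu)// leq_maxl.
have Ce0 : 0 < C * expR 1 by rewrite mulr_gt0// expR_gt0.
have mball : (mu (bowen_ball act (F (node_index u)) z e) <=
    (C * expR 1 * expR (- s * b #|` F (node_index u)| +
       birkhoff_sum act f (F (node_index u)) z))%:E)%E.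
  apply: (@le_trans _ _ (node_length u)%:E).
    apply: (mu_le i u) => //.
      by apply: open_borel_measurable; exact: open_bowen_ball.
    move=> v y vi vy zy; apply/eqP; apply: contraT => vu.
    have : e <= bowen (node_index u) z y.
      by apply: (level_separated ui vi) => //; rewrite eq_sym.
    by rewrite leNgt => /negP; case.
  rewrite lee_fin /node_length -mulrA ler_pM2l// -expRD ler_expR.
  have /fu : mdist (node_center u) z <= node_radius u by rewrite (le_trans uz)//; lra.
  by set p := birkhoff_sum _ _ _ _; set q := birkhoff_sum _ _ _ _; lra.
apply: le_trans (ge_local_rate (b_gt0 _) Ce0 (measure_ge0 _ _) mball).
rewrite lee_fin lerB// -/L ler_pdivrMr// -ler_pdivrMl// mulrC.
apply: le_trans (scale_ge_index F_increasing b_ge _).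
apply/ltW; apply: (lt_le_trans (truncnS_gt _)).
by rewrite ler_nat (leq_trans _ iu)// leq_maxr.
Qed.

End uniform_measure_on_packing.

Lemma exists_measure_local_rate (R : realType) (G : groupType) (X : pMetricType R)
    (act : G -> X -> X) (F : nat -> {fset G}) (f : X -> R) (b : nat -> R)
    (s t e : R) (Z : set X) :
    (forall g, continuous (act g)) -> continuous f -> compact [set: X] ->
    strictly_increasing F -> (forall n, 0 < b n) ->
    (forall n : nat, #|` F n|%:R <= b #|` F n|) ->
    s < t -> 0 < e -> closed Z -> packing_outer act F f b t e Z <> 0%E ->
  exists (mu : probability (borel X) R) (K : set X),
  [/\ measurable (K : set (borel X)), K `<=` Z, mu K = 1%E &
      forall z, K z -> (s%:E <= limn_esup (local_rate act F f b mu e z))%E].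
Proof.
move=> cact cf cX incF b0 bF st e0 cZ Z0.
have [x0 sx0] := packing_support_neq0 cX Z0.
have [r [r0 rf]] := @filter_ex _ (0 : R)^'+ _ _
  (filterI (nbhs_right_gt 0) (near0_birkhoff_sum cact cf (F 0%N) x0)).
pose root : node X := (x0, 0%N, r, 0).
(* The parameters fill [0, 1], so any root interval [0, l) with 1 < l will do. *)
pose C := 2 / node_weight act F f b s root.
have w0 : 0 < node_weight act F f b s root by exact: expR_gt0.
have C0 : 0 < C by rewrite divr_gt0.
have /choice[ch chP] : forall u, exists vs,
    valid_node act F f b t e Z u -> children act F f b s t e Z C u vs.
  move=> u; have [vu|nvu] := pselect (valid_node act F f b t e Z u).
    by have [vs h] := exists_children cact cf cX incF bF st e0 C0 vu; exists vs.
  by exists [::].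
apply: (tree_measure_local_rate cact cX incF b0 bF cZ C0 chP (root := root)) => //.
move=> x /andP[x0' x1]; rewrite /interval_of /node_left x0' add0r.
by rewrite /node_length divfK ?gt_eqF// (le_lt_trans x1)// ltr1n.
Qed.

(** * The variational principle *)

Lemma ereal_between (R : realFieldType) (x y : \bar R) :
  (x < y)%E -> exists r : R, (x < r%:E < y)%E.
Proof.
case: x => [x| |]; case: y => [y| |]//.
- by rewrite lte_fin => xy; exists ((x + y) / 2); rewrite !lte_fin !midf_lt.
- by exists (x + 1); rewrite lte_fin ltrDl ltr01 ltry.
- by exists (y - 1); rewrite ltNyr lte_fin gtrBl ltr01.
- by exists 0; rewrite ltNyr ltry.
Qed.

Lemma unif_norm_ge0 (R : realType) (X : pMetricType R) (f : X -> R) :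
  0 <= unif_norm f.
Proof.
rewrite /unif_norm; set S := (X in sup X).
have [hS|/sup_out->//] := pselect (has_sup S).
apply: le_trans (normr_ge0 (f point)) _.
by apply: ub_le_sup; [case: hS|exists point].
Qed.

Section variational_principle.
Context (R : realType) (G : groupType) (X : pMetricType R).
Context (act : G -> X -> X) (F : nat -> {fset G}) (f : X -> R) (b : nat -> R).
Hypothesis act_continuous : forall g, continuous (act g).
Hypothesis f_continuous : continuous f.
Hypothesis X_compact : compact [set: X].
Hypothesis F_increasing : strictly_increasing F.
Hypothesis b_gt0 : forall n, 0 < b n.
Hypothesis b_ge : forall n : nat, #|` F n|%:R <= b #|` F n|.
Context (Z : set X).
Hypothesis Z_closed : closed Z.

Local Notation P := (packing_pressure act F f b Z).

Lemma upper_pressure_le (mu : probability (borel X) R) :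
  mu Z = 1%E -> (0 <= P)%E -> (upper_pressure act F f b mu <= P)%E.
Proof.
move=> muZ P0; rewrite leNgt; apply/negP => /ereal_between[s /andP[Ps]].
rewrite ltNge => /negP; apply; apply: integral_le_cst.
  by rewrite -lee_fin (le_trans P0)// ltW.
exact: (upper_local_pressure_le_ae act_continuous X_compact F_increasing b_gt0 b_ge
  Z_closed muZ Ps).
Qed.

(** One measure serves the three pressures, because its rates are bounded below
    at one scale and on one set of full measure. *)
Lemma approximating_measure (s : R) : 0 <= s -> (s%:E < P)%E ->
  exists mu : probability (borel X) R, mu Z = 1%E /\
    [/\ (s%:E <= upper_pressure act F f b mu)%E,
        (s%:E <= measure_packing_pressure act F f b mu)%E &
        (s%:E <= katok_packing_pressure act F f b mu)%E].
Proof.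
move=> s0; rewrite packing_pressureE => /ereal_sup_gt[_ [e /= e0 <-]].
move=> /ereal_between[t /andP[st tP]].
have Zt : packing_outer act F f b t e Z <> 0%E.
  move=> Zt; move: tP; rewrite ltNge => /negP; apply.
  by apply: ereal_inf_lbound; exists t.
have [mu [K [mK KZ muK Krate]]] := exists_measure_local_rate act_continuous
  f_continuous X_compact F_increasing b_gt0 b_ge st e0 Z_closed Zt.
exists mu; split.
  have mZ : measurable (Z : set (borel X)) by exact: closed_borel_measurable.
  apply/eqP; rewrite eq_le probability_le1//= -muK.
  by apply: le_measure; rewrite ?inE.
split.
- apply: (integral_ge_cst s0 mK muK) => x.
  exact: (upper_local_pressure_ge act_continuous b_gt0 e0 Krate).
- exact: (measure_packing_pressure_ge act_continuous X_compact F_increasing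
    b_gt0 b_ge e0 mK muK Krate).
- exact: (katok_packing_pressure_ge act_continuous X_compact F_increasing
    b_gt0 b_ge e0 mK muK Krate).
Qed.

Lemma eq_sup_of_approximation (Q : probability (borel X) R -> \bar R) :
    (0 < P)%E ->
    (forall mu : probability (borel X) R, mu Z = 1%E -> (Q mu <= P)%E) ->
    (forall s : R, 0 <= s -> (s%:E < P)%E ->
      exists mu : probability (borel X) R, mu Z = 1%E /\ (s%:E <= Q mu)%E) ->
  P = ereal_sup [set Q mu
    | mu in [set mu : probability (borel X) R | mu Z = 1%E]].
Proof.
move=> P0 QP sQ; apply/eqP; rewrite eq_le; apply/andP; split; last first.
  by apply: ge_ereal_sup => _ [mu /= muZ <-]; exact: QP.
set S := ereal_sup _; rewrite leNgt; apply/negP => SP.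
have /ereal_between[s /andP[]] : (maxe 0 S < P)%E by rewrite gt_max P0.
rewrite gt_max => /andP[s0 Ss] sP.
have [|mu [muZ sQmu]] := sQ s _ sP; first by rewrite -lee_fin ltW.
move: Ss; rewrite ltNge => /negP; apply; apply: le_trans sQmu _.
by apply: ereal_sup_ubound; exists mu.
Qed.

End variational_principle.

Theorem theorem4p1 (R : realType) (G : groupType) (X : pMetricType R)
    (act : G -> X -> X) (F : nat -> {fset G}) (b : nat -> R) (f : X -> R)
    (Z : set X)
    (G_countable : countable [set: G])
    (G_infinite : infinite_set [set: G])
    (G_amenable : amenable R G)
    (X_compact : compact [set: X])
    (act_continuous : continuous_action act)
    (F_Folner : Folner R F)
    (F_increasing : strictly_increasing F)
    (b_scaled : scaled_sequence b)
    (b_ge : forall n : nat, #|` F n|%:R <= b #|` F n|)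
    (f_continuous : continuous f)
    (Z_nonempty : Z !=set0)
    (Z_compact : compact Z)
    (P_gt : ((unif_norm f)%:E < packing_pressure act F f b Z)%E) :
  [/\ packing_pressure act F f b Z
        = ereal_sup [set upper_pressure act F f b mu
                    | mu in [set mu : probability (borel X) R | mu Z = 1%E]],
      packing_pressure act F f b Z
        = ereal_sup [set measure_packing_pressure act F f b mu
                    | mu in [set mu : probability (borel X) R | mu Z = 1%E]] &
      packing_pressure act F f b Z
        = ereal_sup [set katok_packing_pressure act F f b mu
                    | mu in [set mu : probability (borel X) R | mu Z = 1%E]]].
Proof.
have act_cont g : continuous (act g) by case: act_continuous.
have b_gt0 n : 0 < b n by case: b_scaled.
have Z_closed : closed Z.
  exact: (compact_closed (@metric_hausdorff _ X) Z_compact).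
have P0 : (0 < packing_pressure act F f b Z)%E.
  by rewrite (le_lt_trans _ P_gt)// lee_fin unif_norm_ge0.
have approx := approximating_measure act_cont f_continuous X_compact F_increasing
  b_gt0 b_ge Z_closed.
split; apply: eq_sup_of_approximation => //.
- move=> mu muZ; exact: (upper_pressure_le act_cont X_compact F_increasing b_gt0
    b_ge Z_closed muZ (ltW P0)).
- by move=> s s0 sP; have [mu [muZ []]] := approx s s0 sP; exists mu.
- by move=> mu muZ; exact: measure_packing_pressure_le.
- by move=> s s0 sP; have [mu [muZ []]] := approx s s0 sP; exists mu.
- by move=> mu muZ; exact: katok_packing_pressure_le.
- by move=> s s0 sP; have [mu [muZ []]] := approx s s0 sP; exists mu.
Qed.
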